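(* Let $K$ be an algebraically closed field of characteristic zero, let $\lambda\in K$, and let $P_\lambda=P(\mathrm{sl}_2(K))/(C_P-\lambda)$. The group $G=\mathrm{Aut}(P_\lambda)$ of Poisson algebra automorphisms of $P_\lambda$ is generated by the automorphism $\tau$ given by $$\tau(e)=f,\quad \tau(h)=-h,\quad \tau(f)=e$$ together with all automorphisms $\Delta_g$ of the form $$\Delta_g(e)=e-g(f)h-f g(f)^2,\quad \Delta_g(h)=h+2f g(f),\quad \Delta_g(f)=f,$$ where $g(x)$ runs over $K[x]$.
   Context: $\mathrm{sl}_2(K)$ has basis $E,H,F$ with $[E,F]=H$, $[H,E]=2E$, $[H,F]=-2F$. The Poisson enveloping algebra $P(\mathrm{sl}_2(K))$ is the polynomial algebra $K[E,H,F]$ with the unique Poisson bracket (bilinear, Lie, satisfying the Leibniz identity) extending the Lie bracket: $\{E,F\}=H$, $\{H,E\}=2E$, $\{H,F\}=-2F$. The Casimir element is $C_P=4EF+H^2$, which is Poisson-central, so $P_\lambda=P(\mathrm{sl}_2(K))/(C_P-\lambda)$ is a Poisson algebra. The images of $E,H,F$ in $P_\lambda$ are denoted $e,h,f$; they satisfy $\{e,f\}=h$, $\{h,e\}=2e$, $\{h,f\}=-2f$, $4ef+h^2=\lambda$. Automorphisms of $P_\lambda$ are $K$-linear bijections preserving both the commutative product and the Poisson bracket; the group operation is composition of maps. *)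

(* Defs.v *)
From HB Require Import structures.
From mathcomp Require Import all_boot all_order all_algebra.
From mathcomp Require Import generic_quotient ring_quotient.
From mathcomp Require Import boolp.
From mathcomp Require Import mpoly.
From mathcomp Require Import ring.

Set Implicit Arguments.
Unset Strict Implicit.
Unset Printing Implicit Defensive.

Import GRing.Theory.
Local Open Scope ring_scope.
Local Open Scope quotient_scope.

Section PoissonAlgebra.
Variables (K : fieldType) (A : comAlgType K).

Record is_poisson_bracket (br : A -> A -> A) : Prop := IsPoissonBracket {
  pbr_linearl : forall y, linear (br^~ y);
  pbr_linearr : forall x, linear (br x);
  pbr_alt : forall x, br x x = 0;
  pbr_jacobi : forall x y z,
    br x (br y z) + br y (br z x) + br z (br x y) = 0;
  pbr_leibniz : forall x y z, br x (y * z) = br x y * z + y * br x z }.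

Definition is_poisson_aut (br : A -> A -> A) (f : A -> A) : Prop :=
  [/\ linear f,
      {morph f : x y / x * y},
      {morph f : x y / br x y}
    & bijective f].

Record poisson_aut (br : A -> A -> A) := PoissonAut {
  poisson_aut_fun :> A -> A;
  poisson_autP : is_poisson_aut br poisson_aut_fun }.

Variable br : A -> A -> A.

HB.instance Definition _ := gen_eqMixin (poisson_aut br).
HB.instance Definition _ := gen_choiceMixin (poisson_aut br).

Lemma poisson_aut_ext (s t : poisson_aut br) : s =1 t -> s = t.
Proof.
case: s t => [s sP] [t tP] /= /funext est.
by case: t / est tP => tP; congr PoissonAut; apply: Prop_irrelevance.
Qed.

Lemma is_poisson_aut_id : is_poisson_aut br id.
Proof. by split=> //; exists id. Qed.

Lemma is_poisson_aut_comp (s t : poisson_aut br) :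
  is_poisson_aut br (s \o t).
Proof.
case: s t => [s [sl sm sb s_bij]] [t [tl tm tb t_bij]]; split=> /=.
- by move=> a x y /=; rewrite tl sl.
- by move=> x y /=; rewrite tm sm.
- by move=> x y /=; rewrite tb sb.
- exact: bij_comp.
Qed.

Lemma poisson_aut_inv_subproof (s : poisson_aut br) :
  exists t : poisson_aut br, cancel s t /\ cancel t s.
Proof.
case: s => s sP; case: (sP) => sl sm sb [t stK tsK].
have tP : is_poisson_aut br t.
  split; last by exists s.
  - by move=> a x y; apply: (can_inj stK); rewrite sl !tsK.
  - by move=> x y; apply: (can_inj stK); rewrite sm !tsK.
  - by move=> x y; apply: (can_inj stK); rewrite sb !tsK.
by exists (PoissonAut tP).
Qed.

Definition poisson_aut_one := PoissonAut is_poisson_aut_id.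
Definition poisson_aut_mul s t := PoissonAut (is_poisson_aut_comp s t).
Definition poisson_aut_inv s := projT1 (cid (poisson_aut_inv_subproof s)).

Lemma poisson_aut_mulA : associative poisson_aut_mul.
Proof. by move=> r s t; apply: poisson_aut_ext. Qed.
Lemma poisson_aut_mul1g : left_id poisson_aut_one poisson_aut_mul.
Proof. by move=> s; apply: poisson_aut_ext. Qed.
Lemma poisson_aut_mulg1 : right_id poisson_aut_one poisson_aut_mul.
Proof. by move=> s; apply: poisson_aut_ext. Qed.
Lemma poisson_aut_mulVg :
  left_inverse poisson_aut_one poisson_aut_inv poisson_aut_mul.
Proof.
move=> s; apply: poisson_aut_ext => x /=.
by rewrite /poisson_aut_inv; case: cid => t /= [stK _].
Qed.
Lemma poisson_aut_mulgV :
  right_inverse poisson_aut_one poisson_aut_inv poisson_aut_mul.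
Proof.
move=> s; apply: poisson_aut_ext => x /=.
by rewrite /poisson_aut_inv; case: cid => t /= [_ tsK].
Qed.

HB.instance Definition _ := isGroup.Build (poisson_aut br)
  poisson_aut_mulA poisson_aut_mul1g poisson_aut_mulg1
  poisson_aut_mulVg poisson_aut_mulgV.

Lemma poisson_aut1E x : (1%g : poisson_aut br) x = x. Proof. by []. Qed.
Lemma poisson_autME (s t : poisson_aut br) x : (s * t)%g x = s (t x).
Proof. by []. Qed.

Lemma poisson_aut_rmorph1 (s : poisson_aut br) : s 1 = 1.
Proof.
case: s => s [_ sm _ [t stK tsK]] /=.
by rewrite -[LHS]mulr1 -{2}[1]tsK -sm mul1r tsK.
Qed.

End PoissonAlgebra.

(* The intersection of all subgroups of G that contain X. *)
Definition generated (G : groupType) (X : G -> Prop) (x : G) : Prop :=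
  forall S : {pred G}, group_closed S -> (forall y, X y -> y \in S) -> x \in S.

Section PolynomialPoissonAlgebra.
Variable K : fieldType.
Local Notation PP := {mpoly K[3]}.
Local Notation iE := (0 : 'I_3).
Local Notation iH := (1 : 'I_3).
Local Notation iF := (2 : 'I_3).

(* The polynomial ring K[E, H, F] underlying P(sl_2(K)). *)
Definition Psl2_E : PP := 'X_iE.
Definition Psl2_H : PP := 'X_iH.
Definition Psl2_F : PP := 'X_iF.
Local Notation E := Psl2_E.
Local Notation H := Psl2_H.
Local Notation F := Psl2_F.

(* The biderivation with {E, F} = H, {H, E} = 2 E and {H, F} = - 2 F; see    *)
(* Psl2_bracket_poisson and Psl2_bracket_unique.                             *)
Definition Psl2_bracket (p q : PP) : PP :=
  H * (p^`M(iE) * q^`M(iF) - p^`M(iF) * q^`M(iE))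
  + 2 * E * (p^`M(iH) * q^`M(iE) - p^`M(iE) * q^`M(iH))
  - 2 * F * (p^`M(iH) * q^`M(iF) - p^`M(iF) * q^`M(iH)).

Lemma mderiv_var (i j : 'I_3) : ('X_i : PP)^`M(j) = (i == j)%:R.
Proof.
rewrite mderivX mnm1E; case: eqP => [->|_]; last by rewrite scale0r.
suff -> : (U_(j) - U_(j) = 0 :> 'X_{1..3})%MM by rewrite scale1r mpolyX0.
by apply/mnmP => k; rewrite mnmBE mnm0E subnn.
Qed.

Lemma Psl2_bracketEF : Psl2_bracket E F = H.
Proof. by rewrite /Psl2_bracket !mderiv_var /=; ring. Qed.
Lemma Psl2_bracketHE : Psl2_bracket H E = 2 * E.
Proof. by rewrite /Psl2_bracket !mderiv_var /=; ring. Qed.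
Lemma Psl2_bracketHF : Psl2_bracket H F = - 2 * F.
Proof. by rewrite /Psl2_bracket !mderiv_var /=; ring. Qed.

Lemma Psl2_bracket_alt p : Psl2_bracket p p = 0.
Proof. by rewrite /Psl2_bracket; ring. Qed.

Lemma Psl2_bracket_linearl q : linear ((@Psl2_bracket)^~ q).
Proof.
move=> a x y /=.
by rewrite /Psl2_bracket !mderivD !mderivZ -!mul_mpolyC; ring.
Qed.

Lemma Psl2_bracket_linearr p : linear (Psl2_bracket p).
Proof.
move=> a x y /=.
by rewrite /Psl2_bracket !mderivD !mderivZ -!mul_mpolyC; ring.
Qed.

Lemma Psl2_bracket_leibniz p q r :
  Psl2_bracket p (q * r) = Psl2_bracket p q * r + q * Psl2_bracket p r.
Proof. by rewrite /Psl2_bracket !mderivM; ring. Qed.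

Lemma mderiv_nat (i : 'I_3) n : (n%:R : PP)^`M(i) = 0.
Proof. by rewrite -mpolyC_nat mderivC. Qed.

Lemma mderiv_Psl2_bracket (i : 'I_3) p q :
  (Psl2_bracket p q)^`M(i) =
    (iH == i)%:R * (p^`M(iE) * q^`M(iF) - p^`M(iF) * q^`M(iE))
    + 2 * (iE == i)%:R * (p^`M(iH) * q^`M(iE) - p^`M(iE) * q^`M(iH))
    - 2 * (iF == i)%:R * (p^`M(iH) * q^`M(iF) - p^`M(iF) * q^`M(iH))
    + Psl2_bracket p^`M(i) q + Psl2_bracket p q^`M(i).
Proof.
rewrite /Psl2_bracket mderivB mderivD !(mderivM i (_ * _)) mderivM.
rewrite !(mderivM _ 2) mderiv_nat !mderivB !(mderivM i _^`M(_)) !mderiv_var.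
by rewrite !(mderiv_comm i); ring.
Qed.

Lemma Psl2_bracket_jacobi p q r :
  Psl2_bracket p (Psl2_bracket q r) + Psl2_bracket q (Psl2_bracket r p)
    + Psl2_bracket r (Psl2_bracket p q) = 0.
Proof.
rewrite [Psl2_bracket p _]/Psl2_bracket [Psl2_bracket q (_ _ _)]/Psl2_bracket.
rewrite [Psl2_bracket r (_ _ _)]/Psl2_bracket !mderiv_Psl2_bracket /=.
rewrite /Psl2_bracket.
have c (s : PP) : [/\ s^`M(iH)^`M(iE) = s^`M(iE)^`M(iH),
    s^`M(iF)^`M(iE) = s^`M(iE)^`M(iF) & s^`M(iF)^`M(iH) = s^`M(iH)^`M(iF)].
  by split; apply: mderiv_comm.
have [-> -> ->] := c p; have [-> -> ->] := c q; have [-> -> ->] := c r.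
ring.
Qed.

Lemma Psl2_bracket_poisson : is_poisson_bracket (@Psl2_bracket).
Proof.
split; [exact: Psl2_bracket_linearl | exact: Psl2_bracket_linearr
  | exact: Psl2_bracket_alt | exact: Psl2_bracket_jacobi
  | exact: Psl2_bracket_leibniz].
Qed.

Lemma derivation_mpolyE (D : PP -> PP) :
    linear D -> (forall p q, D (p * q) = D p * q + p * D q) ->
  forall p, D p = \sum_i p^`M(i) * D 'X_i.
Proof.
move=> Dl DM.
have D1 : D 1 = 0.
  by have := DM 1 1; rewrite !mulr1 mul1r => /(congr1 (fun x => x - D 1)); rewrite subrr addrK.
have D0 : D 0 = 0.
  by have := Dl (-1) 0 0; rewrite scaler0 addr0 scaleN1r addNr.
pose ok p := D p = \sum_i p^`M(i) * D 'X_i.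
have ok1 : ok 1.
  by rewrite /ok D1 big1 // => i _; rewrite -[1]/(1%:MP) mderivC mul0r.
have okM p q : ok p -> ok q -> ok (p * q).
  rewrite /ok DM => -> ->; rewrite mulr_suml mulr_sumr -big_split /=.
  by apply: eq_bigr => i _; rewrite mderivM; ring.
have okX i : ok 'X_i.
  rewrite /ok (bigD1 i) //= mderiv_var eqxx mul1r big1 ?addr0 // => j ji.
  by rewrite mderiv_var eq_sym (negPf ji) mul0r.
elim/mpolyind => [|c m p _ _ IHp].
  by rewrite D0 big1 // => i _; rewrite mderiv0 mul0r.
have okm : ok 'X_[m].
  rewrite mpolyXE_id; apply: (big_ind ok) => // i _.
  elim: (m i) => [|k IHk]; first by rewrite expr0.
  by rewrite exprS; apply: okM.
rewrite Dl IHp okm scaler_sumr -big_split /=.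
by apply: eq_bigr => i _; rewrite mderivD mderivZ mulrDl scalerAl.
Qed.

Lemma Psl2_bracket_unique (br : PP -> PP -> PP) :
    is_poisson_bracket br ->
    br E F = H -> br H E = 2 * E -> br H F = - 2 * F ->
  br =2 @Psl2_bracket.
Proof.
case=> brl brr balt _ bleib bEF bHE bHF.
have bDl x y z : br (x + y) z = br x z + br y z.
  by have := brl z 1 x y; rewrite /= !scale1r.
have bDr x y z : br z (x + y) = br z x + br z y.
  by have := brr z 1 x y; rewrite !scale1r.
have bC p q : br p q = - br q p.
  by have := balt (p + q); rewrite bDl !bDr !balt addr0 add0r => /addr0_eq <-; rewrite opprK.
have bX i j : br 'X_i 'X_j = Psl2_bracket 'X_i 'X_j.
  have bcC p q : Psl2_bracket p q = - Psl2_bracket q p.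
    by rewrite /Psl2_bracket; ring.
  have cases k : [\/ k = iE, k = iH | k = iF].
    by case: k => [[|[|[|//]]] ?]; [constructor 1|constructor 2|constructor 3];
       apply: val_inj.
  case: (cases i) => ->; case: (cases j) => ->;
    rewrite -/E -/H -/F ?balt ?Psl2_bracket_alt //;
    rewrite ?(bEF, bHE, bHF, Psl2_bracketEF, Psl2_bracketHE, Psl2_bracketHF) //;
    rewrite bC bcC;
    by rewrite ?(bEF, bHE, bHF, Psl2_bracketEF, Psl2_bracketHE, Psl2_bracketHF).
have ext p (D1 D2 : PP -> PP) :
    linear D1 -> (forall p q, D1 (p * q) = D1 p * q + p * D1 q) ->
    linear D2 -> (forall p q, D2 (p * q) = D2 p * q + p * D2 q) ->
    (forall i, D1 'X_i = D2 'X_i) -> D1 p = D2 p.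
  move=> l1 m1 l2 m2 e12; rewrite (derivation_mpolyE l1 m1).
  rewrite (derivation_mpolyE l2 m2).
  by apply: eq_bigr => i _; rewrite e12.
move=> p q.
apply: (ext q (br p) (Psl2_bracket p)) => //.
- exact: Psl2_bracket_linearr.
- exact: Psl2_bracket_leibniz.
move=> j; apply: (ext p (br^~ 'X_j) ((@Psl2_bracket)^~ 'X_j)) => //=.
- by move=> u v; rewrite bC bleib ![br 'X_j _]bC; ring.
- exact: Psl2_bracket_linearl.
- by move=> u v; rewrite /Psl2_bracket !mderivM; ring.
Qed.

Definition Casimir : PP := 4 * E * F + H ^+ 2.

Lemma Casimir_central p : Psl2_bracket p Casimir = 0.
Proof.
have d4 i : (4 : PP)^`M(i) = 0 by rewrite -mpolyC_nat mderivC.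
rewrite /Psl2_bracket /Casimir expr2.
by rewrite !(mderivD, mderivM, d4, mderiv_var) /=; ring.
Qed.

Variable lambda : K.

(* The ideal (C_P - lambda); it is proper, so that it is an instance of      *)
(* [idealr], because E = F = 0 maps C_P - lambda to H^2 - lambda in K[H].    *)
Definition Casimir_ideal : pred PP :=
  fun p => `[< exists q, p = q * (Casimir - lambda%:MP) >].

Lemma Casimir_idealP p :
  reflect (exists q, p = q * (Casimir - lambda%:MP)) (p \in Casimir_ideal).
Proof. exact: asboolP. Qed.

Lemma Casimir_ideal_closed : idealr_closed Casimir_ideal.
Proof.
split.
- by apply/Casimir_idealP; exists 0; rewrite mul0r.
- apply/Casimir_idealP => -[q].
  pose h (i : 'I_3) : {poly K} := if i == iH then 'X else 0.
  pose ev : {rmorphism PP -> {poly K}} := mmap (@polyC K) h.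
  have evX i : ev 'X_i = h i by rewrite /ev /= mmapX mmap1U.
  have evC c : ev c%:MP = c%:P by rewrite /ev /= mmapC.
  move=> /(congr1 ev); rewrite rmorph1 rmorphM rmorphB rmorphD rmorphM.
  rewrite rmorphXn !evX evC /h /= mulr0 add0r => e1.
  have := congr1 (fun p : {poly K} => size p) e1.
  have sz : size ('X^2 - lambda%:P) = 3 by rewrite size_XnsubC.
  have nz : 'X^2 - lambda%:P != 0 by rewrite -size_poly_gt0 sz.
  case: (eqVneq (ev q) 0) => [->|qnz].
    by rewrite mul0r size_poly1 size_poly0.
  rewrite size_poly1 size_mul // sz addnC /=.
  by move: qnz; rewrite -size_poly_gt0; case: (size _).
- move=> a u v /Casimir_idealP[p ->] /Casimir_idealP[q ->].
  by apply/Casimir_idealP; exists (a * p + q); rewrite mulrDl mulrA.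
Qed.

HB.instance Definition _ := isIdealr.Build PP Casimir_ideal Casimir_ideal_closed.

Definition Casimir_idealr : idealr PP := Casimir_ideal.

Definition Plambda : Type := {ideal_quot Casimir_idealr}.

HB.instance Definition _ := GRing.ComNzRing.on Plambda.
HB.instance Definition _ := EqQuotient.on Plambda.


Local Notation Pl := Plambda.
Local Notation pi := (\pi_Pl : PP -> Pl).

Lemma Plambda_piP p q :
  reflect (exists r, p - q = r * (Casimir - lambda%:MP)) (pi p == pi q).
Proof.
have <- : (p - q \in Casimir_ideal) = (pi p == pi q).
  by rewrite -Quotient.idealrBE.
exact: Casimir_idealP.
Qed.

Lemma Plambda_piK x : pi (repr x) = x.
Proof. exact: reprK. Qed.

Definition Plambda_scale (c : K) (x : Pl) : Pl := pi c%:MP * x.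

Lemma Plambda_scaleA a b x :
  Plambda_scale a (Plambda_scale b x) = Plambda_scale (a * b) x.
Proof. by rewrite /Plambda_scale mulrA mpolyCM rmorphM. Qed.
Lemma Plambda_scale1 : left_id 1 Plambda_scale.
Proof. by move=> x; rewrite /Plambda_scale rmorph1 mul1r. Qed.
Lemma Plambda_scaleDr : right_distributive Plambda_scale +%R.
Proof. by move=> a x y; rewrite /Plambda_scale mulrDr. Qed.
Lemma Plambda_scaleDl x : {morph Plambda_scale^~ x : a b / a + b}.
Proof. by move=> a b; rewrite /Plambda_scale mpolyCD rmorphD mulrDl. Qed.

HB.instance Definition _ := GRing.Zmodule_isLmodule.Build K Pl
  Plambda_scaleA Plambda_scale1 Plambda_scaleDr Plambda_scaleDl.

Lemma Plambda_scaleAl (a : K) (x y : Pl) : a *: (x * y) = (a *: x) * y.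
Proof. exact: mulrA. Qed.
HB.instance Definition _ := GRing.Lmodule_isLalgebra.Build K Pl Plambda_scaleAl.

Lemma Plambda_scaleAr (a : K) (x y : Pl) : a *: (x * y) = x * (a *: y).
Proof. exact: mulrCA. Qed.
HB.instance Definition _ := GRing.Lalgebra_isAlgebra.Build K Pl Plambda_scaleAr.

Lemma Plambda_pi_is_linear : linear pi.
Proof. by move=> a p q; rewrite -mul_mpolyC rmorphD rmorphM. Qed.

(* Independent of the representatives: see Plambda_bracket_pi. *)
Definition Plambda_bracket (x y : Pl) : Pl :=
  pi (Psl2_bracket (repr x) (repr y)).

Lemma Psl2_bracketC p q : Psl2_bracket p q = - Psl2_bracket q p.
Proof. by rewrite /Psl2_bracket; ring. Qed.

Lemma Plambda_bracket_pi p q :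
  Plambda_bracket (pi p) (pi q) = pi (Psl2_bracket p q).
Proof.
have pbl u v w : pi u = pi v -> pi (Psl2_bracket w u) = pi (Psl2_bracket w v).
  move=> /eqP/Plambda_piP[r uv]; apply/eqP/Plambda_piP.
  exists (Psl2_bracket w r).
  have bB a b : Psl2_bracket w (a - b) = Psl2_bracket w a - Psl2_bracket w b.
    by rewrite /Psl2_bracket !mderivB; ring.
  rewrite -bB uv Psl2_bracket_leibniz bB Casimir_central.
  have -> : Psl2_bracket w lambda%:MP = 0.
    by rewrite /Psl2_bracket !mderivC; ring.
  by rewrite subr0 mulr0 addr0.
rewrite /Plambda_bracket (pbl _ q) ?reprK // Psl2_bracketC.
by rewrite raddfN /= (pbl _ p) ?reprK // -raddfN -Psl2_bracketC.
Qed.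

Lemma Plambda_bracket_poisson : is_poisson_bracket Plambda_bracket.
Proof.
have [bl br ba bj bL] := Psl2_bracket_poisson.
have piZ a (p : PP) : a *: pi p = pi (a *: p).
  by rewrite -mul_mpolyC rmorphM.
split=> [y a x z|x a y z|x|x y z|x y z] /=.
- rewrite -[x]Plambda_piK -[y]Plambda_piK -[z]Plambda_piK.
  by rewrite piZ -rmorphD !Plambda_bracket_pi piZ -rmorphD bl.
- rewrite -[x]Plambda_piK -[y]Plambda_piK -[z]Plambda_piK.
  by rewrite piZ -rmorphD !Plambda_bracket_pi piZ -rmorphD br.
- by rewrite -[x]Plambda_piK Plambda_bracket_pi ba rmorph0.
- rewrite -[x]Plambda_piK -[y]Plambda_piK -[z]Plambda_piK.
  by rewrite !Plambda_bracket_pi -!rmorphD bj rmorph0.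
- rewrite -[x]Plambda_piK -[y]Plambda_piK -[z]Plambda_piK.
  by rewrite -(rmorphM \pi_Pl) !Plambda_bracket_pi bL rmorphD !rmorphM.
Qed.

Definition Plambda_e : Pl := pi E.
Definition Plambda_h : Pl := pi H.
Definition Plambda_f : Pl := pi F.
Local Notation e := Plambda_e.
Local Notation h := Plambda_h.
Local Notation f := Plambda_f.

Lemma Plambda_bracket_ef : Plambda_bracket e f = h.
Proof. by rewrite Plambda_bracket_pi Psl2_bracketEF. Qed.
Lemma Plambda_bracket_he : Plambda_bracket h e = 2 * e.
Proof. by rewrite Plambda_bracket_pi Psl2_bracketHE rmorphM rmorph_nat. Qed.
Lemma Plambda_bracket_hf : Plambda_bracket h f = - 2 * f.
Proof.
by rewrite Plambda_bracket_pi Psl2_bracketHF rmorphM rmorphN rmorph_nat.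
Qed.
Lemma Plambda_rel : 4 * e * f + h ^+ 2 = lambda%:A.
Proof.
transitivity (pi Casimir).
  by rewrite /Casimir rmorphD !rmorphM rmorph_nat.
transitivity (pi lambda%:MP); last by rewrite /GRing.scale /= /Plambda_scale mulr1.
by apply/eqP/Plambda_piP; exists 1; rewrite mul1r.
Qed.

Definition Plambda_aut := poisson_aut Plambda_bracket.

HB.instance Definition _ := Group.on Plambda_aut.

Lemma Plambda_aut_ext (s t : Plambda_aut) :
  s e = t e -> s h = t h -> s f = t f -> s = t.
Proof.
move=> ste sth stf; apply: poisson_aut_ext => x.
have s1 := poisson_aut_rmorph1 s; have t1 := poisson_aut_rmorph1 t.
have [[sl sm _ _] [tl tm _ _]] := (poisson_autP s, poisson_autP t).
rewrite -[x]Plambda_piK; set p := repr x.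
pose ok p := s (pi p) = t (pi p).
have ok1 : ok 1 by rewrite /ok rmorph1 s1 t1.
have okM u v : ok u -> ok v -> ok (u * v).
  by rewrite /ok (rmorphM \pi_Pl) sm tm => -> ->.
have okX i : ok 'X_i.
  by case: i => [[|[|[|//]]] ?]; rewrite /ok;
    [move: ste | move: sth | move: stf]; congr (s (pi 'X__) = t (pi 'X__));
    apply: val_inj.
have okZD c u v : ok u -> ok v -> ok (c *: u + v).
  by rewrite /ok (Plambda_pi_is_linear c) sl tl => -> ->.
elim/mpolyind: p => [|c m p _ _]; last apply: okZD.
  by have := okZD (-1) 1 1 ok1 ok1; rewrite scaleN1r addNr.
rewrite mpolyXE_id; apply: (big_ind ok) => // i _.
by elim: (m i) => [|k IHk]; rewrite ?expr0 // exprS; apply: okM.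
Qed.

Definition is_tau (s : Plambda_aut) : Prop :=
  [/\ s e = f, s h = - h & s f = e].

Definition is_Delta (g : {poly K}) (s : Plambda_aut) : Prop :=
  let gf := horner_alg f g in
  [/\ s e = e - gf * h - f * gf ^+ 2, s h = h + 2 * f * gf & s f = f].

End PolynomialPoissonAlgebra.

(* Main.v *)
Require Import Defs.
From HB Require Import structures.
From mathcomp Require Import all_boot all_order all_algebra.
From mathcomp Require Import generic_quotient fraction.
From mathcomp Require Import boolp mpoly.
From mathcomp Require Import ring zify.

Set Implicit Arguments.
Unset Strict Implicit.
Unset Printing Implicit Defensive.

Import GRing.Theory.
Local Open Scope ring_scope.
Local Open Scope quotient_scope.

(** Every [s] is brought to a simple form by multiplying it on the left by [tau]
    and by the [Delta g], and everything is read off the single element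
    [a = s f].

    Since [4 * e * f = lambda - h ^ 2], the algebra embeds in K[f, 1/f][h], so
    an element has a Newton polygon in the monomials [f ^ k * h ^ j], with [k]
    possibly negative.  It is uniquely, up to polynomials in [h], of the form
    U(e, h) + V(f, h) ([normal_form_ex]).  If [m] and [n] bound the degree of U
    in [e] and that of V in [f], then [f ^ m * a] is a polynomial P in [f] and
    [h] of degree at most [m + n] in [f], and conversely
    ([ev_fh_of_normal_form], [normal_form_of_ev_fh]).  The automorphism [tau]
    exchanges [m] and [n], so suppose [m <= n].  The sum [m + n] is lowered as
    long as [a] is not a polynomial in [f].

    The tool is that [ad f] is locally nilpotent ([ad_f_nilpotent]), hence so is
    [ad a].  Give [f] the weight [r] and [h] the weight [l], that is, put
    [f = z ^ r] and [h = z ^ l * T].  The leading coefficient in [z] of [a] is a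
    polynomial L(T), and those of the iterates [ad(a)^i f] satisfy a recursion
    that can be followed at a root [c] of L: if [c] has multiplicity [mu] and
    the weight of [a] is at least [l * mu], then the order at [c] and the
    leading coefficient there are explicit and nonzero, so no iterate vanishes
    ([ad_iter_neq0]).  Local nilpotency thus forces every root to satisfy
    [l * mu > weight].

    Apply this to the side of the polygon that starts at the vertex [f ^ n]
    ([newton_edge_shear]).  Its weight is [r * n], so each root of L satisfies
    [l * mu > r * n]; but no exponent of [f] lies below [- m >= - n], which
    bounds [l * deg L] by [2 * r * n].  Two distinct roots do not fit, so L is a
    multiple of [(T - c) ^ d] with [c != 0].  In characteristic zero such a
    polynomial has a nonzero coefficient at [T], which makes the slope [l / r]
    an integer [q].  The substitution [h -> h + c * f ^ q] is realized by the
    [Delta g] with [2 * f * g(f) = c * f ^ q] ([Delta_ev_fh]).  It kills the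
    vertex [f ^ n] and changes no exponent bound from below, so [n] drops.

    When [s f] is a polynomial in [f], it is affine in [f], because the
    centralizer of [f] is K[f] and contains [s^-1 f] as well
    ([image_f_affine]).  The brackets and the relation defining the algebra
    then leave only [s = Delta g * t] with [t] rescaling [f] and fixing [h]
    ([mem_of_image_f_poly]), and [t] is a word in [tau] and the [Delta g] with
    constant [g] ([torus_in]). *)

(** * Preliminaries *)

Lemma size_mul_leq_top (R : nzRingType) (p q : {poly R}) a b :
  (size p <= a.+1)%N -> (size q <= b.+1)%N -> (size (p * q)%R <= (a + b).+1)%N.
Proof. by move=> sp sq; apply: leq_trans (size_polyMleq _ _) _; lia. Qed.

Lemma coefM_top (R : nzRingType) (p q : {poly R}) a b :
  (size p <= a.+1)%N -> (size q <= b.+1)%N -> (p * q)`_(a + b) = p`_a * q`_b.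
Proof.
move=> /leq_sizeP sp /leq_sizeP sq; have ltab : (a < (a + b).+1)%N by lia.
rewrite coefM (bigD1 (Ordinal ltab)) //= addKn big1 ?addr0 // => i /eqP ia.
have {}ia : (i != a :> nat) by apply/eqP => E; apply: ia; apply: val_inj.
have [ltia|gtia|/eqP] := ltngtP i a; last by rewrite (negPf ia).
- by rewrite sq ?mulr0 //; lia.
- by rewrite sp ?mul0r //; lia.
Qed.

(** Ratios are compared by cross multiplication; this selects the slope of a
    side of the Newton polygon. *)
Lemma min_ratio (T : eqType) (s : seq T) (x0 : T) (a b : T -> nat) :
    x0 \in s -> {in s, forall x, 0 < b x}%N ->
  exists2 x, x \in s & {in s, forall y, a x * b y <= a y * b x}%N.
Proof.
elim: s x0 => // z s IH x0 _ b0.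
have bz : (0 < b z)%N by apply: b0; rewrite mem_head.
case: s IH b0 => [_ _|y s IH b0].
  by exists z; rewrite ?mem_head // => y; rewrite inE => /eqP ->.
have [||x xs xmin] := IH y; first exact: mem_head.
  by move=> t ts; apply: b0; rewrite inE ts orbT.
have bx : (0 < b x)%N by apply: b0; rewrite inE xs orbT.
case: (leqP (a z * b x) (a x * b z)) => zx.
  exists z; rewrite ?mem_head // => t; rewrite inE => /predU1P[-> //|ts].
  have bt : (0 < b t)%N by apply: b0; rewrite inE ts orbT.
  have xt := xmin _ ts; rewrite -(leq_pmul2r bx).
  apply: (@leq_trans (a x * b z * b t)%N).
    by rewrite mulnAC [(_ * b z * _)%N]mulnC mulnC leq_pmul2l.
  by rewrite mulnAC [(a t * _ * _)%N]mulnAC leq_pmul2r.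
exists x; first by rewrite inE xs orbT.
by move=> t; rewrite inE => /predU1P[->|/xmin //]; apply: ltnW.
Qed.

Lemma natf_neq0_pchar0 (K : fieldType) (charK : [pchar K] =i pred0) n :
  (0 < n)%N -> n%:R != 0 :> K.
Proof. by have /pcharf0P -> := charK; rewrite lt0n. Qed.

Lemma horner_alg_comp (K : comNzRingType) (B : comAlgType K) (x : B)
    (p q : {poly K}) :
  horner_alg x (p \Po q) = horner_alg (horner_alg x q) p.
Proof.
elim/poly_ind: p => [|p c IH]; first by rewrite comp_poly0 !rmorph0.
rewrite comp_poly_MXaddC !rmorphD !rmorphM /= IH.
by rewrite !horner_algC horner_algX.
Qed.

(** * Bivariate polynomials and weights *)

Section Bipoly.
Variable K : fieldType.
Local Notation W := {poly {poly K}}.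

(* A polynomial in [f] (or [e]) and [h] is encoded with [f] as the outer and [h]
   as the inner variable. *)

Lemma bipoly_ind (Pr : W -> Prop) :
    (forall c, Pr c%:P%:P) -> (forall P Q, Pr P -> Pr Q -> Pr (P + Q)) ->
    (forall P, Pr P -> Pr (P * 'X)) -> (forall P, Pr P -> Pr (P * 'X%:P)) ->
  forall P, Pr P.
Proof.
move=> PrC PrD PrX PrY; elim/poly_ind => [|P p IH]; first exact: PrC 0.
apply: (PrD); first exact: PrX.
elim/poly_ind: p => [|p c IHp]; first exact: PrC 0.
by rewrite polyCD polyCM; apply: (PrD); [exact: PrY|].
Qed.

Definition deriv_in : {additive W -> W} := map_poly (@deriv K).

Lemma coef_deriv_in P k : (deriv_in P)`_k = (P`_k)^`().
Proof. exact: coef_map. Qed.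

Lemma deriv_inC p : deriv_in p%:P = (p^`())%:P.
Proof. by rewrite /deriv_in /= map_polyC. Qed.

Lemma deriv_inX : deriv_in 'X = 0.
Proof.
by apply/polyP => k; rewrite coef_deriv_in coefX coef0 derivMn derivE mul0rn.
Qed.

Lemma deriv_inM P Q : deriv_in (P * Q) = deriv_in P * Q + P * deriv_in Q.
Proof.
apply/polyP => k; rewrite coefD !coefM coef_deriv_in coefM raddf_sum -big_split.
by apply: eq_bigr => i _ /=; rewrite !coef_deriv_in -derivM.
Qed.

Section Eval.
Variables (B : comNzRingType) (iota : {rmorphism K -> B}) (a b : B).

(** Locked and typed as a morphism, because unification would otherwise unfold
    it on iterated polynomial rings. *)
Fact bieval_key : unit. Proof. exact: tt. Qed.
Definition bieval : {rmorphism W -> B} := locked_with bieval_key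
  (horner_eval a \o map_poly (horner_eval b \o map_poly iota)
    : {rmorphism W -> B}).

Lemma bievalX : bieval 'X = a.
Proof. by rewrite /bieval unlock /= map_polyX /horner_eval hornerX. Qed.
Lemma bievalC p : bieval p%:P = (map_poly iota p).[b].
Proof. by rewrite /bieval unlock /= map_polyC /horner_eval /= hornerC. Qed.
Lemma bievalY : bieval 'X%:P = b.
Proof. by rewrite bievalC map_polyX hornerX. Qed.
Lemma bievalCC c : bieval c%:P%:P = iota c.
Proof. by rewrite bievalC map_polyC hornerC. Qed.

Lemma bieval_map_polyC (p : {poly K}) : bieval (p^:P) = (map_poly iota p).[a].
Proof.
elim/poly_ind: p => [|p c IH]; first by rewrite !rmorph0 horner0.
by rewrite !(rmorphD, rmorphM) /= !map_polyX !map_polyC /= bievalCC bievalX IH !hornerE.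
Qed.

(** Used both for the derivations of polynomial rings and for a Poisson bracket
    with one argument fixed. *)
Lemma bieval_chain_rule (d : B -> B) (dD : {morph d : x y / x + y})
    (dM : forall x y, d (x * y) = d x * y + x * d y)
    (dC : forall c, d (iota c) = 0) P :
  d (bieval P) = bieval P^`() * d a + bieval (deriv_in P) * d b.
Proof.
elim/bipoly_ind: P => [c|P Q IHP IHQ|P IH|P IH].
- by rewrite bievalCC dC derivC deriv_inC derivC !raddf0 !mul0r addr0.
- by rewrite !raddfD /= dD IHP IHQ; ring.
- rewrite derivM deriv_inM derivX deriv_inX mulr1 mulr0 addr0.
  by rewrite !(rmorphD bieval) !(rmorphM bieval) bievalX dM IH; ring.
- rewrite derivM deriv_inM derivC deriv_inC derivX mulr1 mulr0 addr0.
  by rewrite !(rmorphD bieval) !(rmorphM bieval) bievalY dM IH; ring.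
Qed.

End Eval.

Lemma bipoly_rmorph_eq (B : comNzRingType) (u v : {rmorphism W -> B}) :
    (forall c, u c%:P%:P = v c%:P%:P) -> u 'X = v 'X -> u 'X%:P = v 'X%:P ->
  u =1 v.
Proof.
move=> uvC uvX uvY; elim/bipoly_ind => [//|P Q|P|P].
- by rewrite !rmorphD => -> ->.
- by rewrite !rmorphM uvX => ->.
- by rewrite !rmorphM uvY => ->.
Qed.

(** The substitution [f = z ^ r], [h = z ^ l * T], where [z] is the outer and [T]
    the inner variable of the target: the degree in [z] is then the weight, and
    the coefficient of a power of [z] is the weighted homogeneous part,
    dehomogenized to a polynomial in [T]. *)
Definition weight_sub (r l : nat) : {rmorphism W -> W} :=
  bieval (polyC \o polyC) 'X^r ('X%:P * 'X^l).

Lemma weight_subX r l : weight_sub r l 'X = 'X^r. Proof. exact: bievalX. Qed.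
Lemma weight_subY r l : weight_sub r l 'X%:P = 'X%:P * 'X^l.
Proof. exact: bievalY. Qed.
Lemma weight_subC r l c : weight_sub r l c%:P%:P = c%:P%:P.
Proof. exact: bievalCC. Qed.

(** The operator [z * d/dz], which multiplies [z ^ k] by [k] and so survives the
    clearing of denominators in [z]. *)
Fact euler_key : unit. Proof. exact: tt. Qed.
Definition euler : W -> W := locked_with euler_key (fun P => 'X * P^`()).
Lemma eulerE P : euler P = 'X * P^`().
Proof. by rewrite /euler unlock. Qed.

Lemma coef_euler P k : (euler P)`_k = P`_k *+ k.
Proof.
rewrite eulerE coefXM; case: k => [|k] /=; first by rewrite mulr0n.
by rewrite coef_deriv.
Qed.

Lemma deriv_in_weight_sub r l P :
  deriv_in (weight_sub r l P) = 'X^l * weight_sub r l (deriv_in P).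
Proof.
have dXn k : deriv_in 'X^k = 0.
  elim: k => [|k IH]; first by rewrite expr0 deriv_inC -[1]/(1%:P) derivC.
  by rewrite exprS deriv_inM IH deriv_inX mul0r mulr0 addr0.
rewrite /weight_sub (@bieval_chain_rule _ _ _ _ deriv_in).
- by rewrite dXn deriv_inM dXn deriv_inC derivX; ring.
- by move=> x y; rewrite raddfD.
- exact: deriv_inM.
- by move=> c; rewrite /= deriv_inC derivC.
Qed.

Lemma euler_weight_sub r l P :
  euler (weight_sub r l P) =
  weight_sub r l (euler P) *+ r + 'X%:P * deriv_in (weight_sub r l P) *+ l.
Proof.
have tXn k : euler 'X^k = 'X^k *+ k.
  rewrite eulerE derivXn; case: k => [|k]; first by rewrite !mulr0n mulr0.
  by rewrite mulrnAr -exprS.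
have tM x y : euler (x * y) = euler x * y + x * euler y.
  by rewrite !eulerE derivM; ring.
rewrite deriv_in_weight_sub /weight_sub (@bieval_chain_rule _ _ _ _ euler).
- have t0 : euler 'X%:P = 0 by rewrite eulerE derivC mulr0.
  rewrite tM !tXn t0 (eulerE P).
  by rewrite rmorphM /= bievalX; ring.
- by move=> x y; rewrite !eulerE derivD mulrDr.
- exact: tM.
- by move=> c; rewrite eulerE /= derivC mulr0.
Qed.

Lemma coef_weight_subC r l (p : {poly K}) w j :
  ((weight_sub r l p%:P)`_w)`_j = if w == (l * j)%N then p`_j else 0.
Proof.
elim/poly_ind: p w j => [|p c IH] w j.
  by rewrite rmorph0 !coef0 if_same.
rewrite polyCD polyCM rmorphD rmorphM /= /weight_sub bievalY bievalCC /= mulrA.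
rewrite !coefD coefMX coefMXn coefMC -/(weight_sub r l p%:P) !coefC.
have -> : (if w == 0%N then c%:P else 0)`_j =
    if (w == 0%N) && (j == 0%N) then c else 0.
  by case: (w == 0%N); [rewrite coefC | rewrite coef0].
case: j => [|j] /=.
  rewrite muln0 andbT; case: (w < l)%N; first by rewrite coef0 !add0r.
  by rewrite coefMX /= !add0r.
rewrite andbF !addr0; case: ltnP => wl.
  by rewrite coef0; case: eqP => // ?; exfalso; lia.
by rewrite coefMX /= IH; congr (if _ then _ else _); lia.
Qed.

Lemma coef_weight_sub r l P w j :
  ((weight_sub r l P)`_w)`_j =
  \sum_(k < size P) if w == (l * j + r * k)%N then (P`_k)`_j else 0.
Proof.
rewrite -{1}[P]coefK poly_def rmorph_sum /= !coef_sum; apply: eq_bigr => k _.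
rewrite -mul_polyC rmorphM rmorphXn /= {2}/weight_sub bievalX -exprM coefMXn.
case: ltnP => wk; last by rewrite coef_weight_subC; congr (if _ then _ else _); lia.
by rewrite coef0; case: eqP => // ?; exfalso; lia.
Qed.

Lemma coef_weight_sub_monomial r l P k j : (0 < r)%N ->
  ((weight_sub r l P)`_(l * j + r * k))`_j = (P`_k)`_j.
Proof.
move=> r0; rewrite coef_weight_sub.
under eq_bigr => i _ do rewrite eqn_add2l eqn_pmul2l //.
case: (ltnP k (size P)) => kP; last first.
  rewrite (nth_default 0 kP) coef0 big1 // => i _.
  by case: eqP => // ki; have := ltn_ord i; rewrite -ki ltnNge kP.
rewrite (bigD1 (Ordinal kP)) //= eqxx big1 ?addr0 // => i /eqP ik.
by case: eqP => // E; case: ik; apply: val_inj.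
Qed.

Lemma coef_weight_sub_neq0 r l P w j : ((weight_sub r l P)`_w)`_j != 0 ->
  exists2 k, w = (l * j + r * k)%N & (P`_k)`_j != 0.
Proof.
rewrite coef_weight_sub => nz; pose F (k : 'I_(size P)) : K :=
  if w == (l * j + r * k)%N then (P`_k)`_j else 0.
have [k /andP[/eqP wk Pk]|none] := pickP (fun k : 'I_(size P) =>
    (w == (l * j + r * k)%N) && ((P`_k)`_j != 0)); first by exists k.
case/eqP: nz; rewrite big1 // => k _; have := none k.
by case: eqP => //= _ /negbFE/eqP.
Qed.

(** The effect on K[f][h] of the [Delta g] with [2 * f * g(f) = c * f ^ q]. *)
Definition shear (c : K) (q : nat) : {rmorphism W -> W} :=
  bieval (polyC \o polyC) 'X ('X%:P + c%:P%:P * 'X^q).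

Lemma shearX c q : shear c q 'X = 'X. Proof. exact: bievalX. Qed.
Lemma shearY c q : shear c q 'X%:P = 'X%:P + c%:P%:P * 'X^q.
Proof. exact: bievalY. Qed.
Lemma shearC c q d : shear c q d%:P%:P = d%:P%:P. Proof. exact: bievalCC. Qed.

(** In the weights [(1, q)] the shear is homogeneous: it is the translation of
    [T] by [c]. *)
Lemma weight_sub_shear c q P :
  weight_sub 1 q (shear c q P) =
  map_poly (comp_poly ('X + c%:P)) (weight_sub 1 q P).
Proof.
have -> : map_poly (comp_poly ('X + c%:P)) (weight_sub 1 q P) =
  (map_poly (comp_poly ('X + c%:P)) \o weight_sub 1 q) P by [].
rewrite -[LHS]/((weight_sub 1 q \o shear c q) P).
apply: bipoly_rmorph_eq => [d||] /=.
- by rewrite shearC !weight_subC map_polyC /= comp_polyC.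
- by rewrite shearX !weight_subX map_polyXn.
- rewrite shearY (rmorphD (weight_sub 1 q)) (rmorphM (weight_sub 1 q)).
  rewrite (rmorphXn (weight_sub 1 q)).
  rewrite weight_subY weight_subC weight_subX expr1 [RHS]rmorphM /=.
  rewrite map_polyC map_polyXn /=.
  by rewrite comp_polyX polyCD mulrDl.
Qed.

(** Only [h]-free monomials reach the exponent [M] of [f] after the shear, and
    they come from the leading part; their coefficient is its value at [c]. *)
Lemma size_shear_lt (c : K) q M P : (0 < q)%N ->
    (size (weight_sub 1 q P) <= M.+1)%N -> root (weight_sub 1 q P)`_M c ->
  (size (shear c q P) <= M)%N.
Proof.
move=> q0 /leq_sizeP sP rc; apply/leq_sizeP => k Mk.
apply/polyP => j; rewrite coef0.
rewrite -(coef_weight_sub_monomial q (shear c q P) k j (ltn0Sn 0)).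
rewrite weight_sub_shear coef_map /=; have [E|nE] := eqVneq (q * j + 1 * k)%N M.
  rewrite E; have -> : j = 0%N by nia.
  rewrite -horner_coef0 horner_comp !hornerE.
  exact/eqP.
by rewrite sP ?comp_poly0 ?coef0 //; lia.
Qed.

(** * Non-nilpotency from a leading form *)

Section Criterion.
Hypothesis charK : [pchar K] =i pred0.

(** The bracket of [P / f ^ N] and [Q / f ^ M], up to the factor [-2] and the
    denominator [f ^ (N + M)]; see [br_twisted]. *)
Definition twisted_bracket (N M : nat) (P Q : W) : W :=
  deriv_in P * (euler Q - Q *+ M) - (euler P - P *+ N) * deriv_in Q.

(** The numerators of the iterates on [f] of the bracket with [P / f ^ N]; see
    [ev_fh_ad_iter]. *)
Fixpoint ad_iter (N : nat) (P : W) (i : nat) : W :=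
  if i is i'.+1 then twisted_bracket N (i' * N) P (ad_iter N P i') else 'X.

Lemma eulerXnM k (P : W) : euler ('X^k * P) = 'X^k * (euler P + P *+ k).
Proof.
rewrite !eulerE derivM derivXn; case: k => [|k]; first by rewrite expr0; ring.
by rewrite exprS /=; ring.
Qed.

Lemma deriv_inXnM k (P : W) : deriv_in ('X^k * P) = 'X^k * deriv_in P.
Proof.
apply/polyP => i; rewrite coef_deriv_in !coefXnM coef_deriv_in.
by case: ifP => //; rewrite deriv0.
Qed.

(** The bracket is homogeneous of weight [- l]; the terms in which [euler] meets
    the [z] hidden in [h = z ^ l * T] cancel. *)
Lemma weight_sub_twisted r l N M P Q :
  ('X^l * weight_sub r l (twisted_bracket N M P Q)) *+ r =
  deriv_in (weight_sub r l P) * (euler (weight_sub r l Q) - weight_sub r l Q *+ (r * M))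
  - (euler (weight_sub r l P) - weight_sub r l P *+ (r * N)) * deriv_in (weight_sub r l Q).
Proof.
rewrite (euler_weight_sub r l P) (euler_weight_sub r l Q) (deriv_in_weight_sub r l P).
rewrite (deriv_in_weight_sub r l Q) /twisted_bracket.
rewrite rmorphB !rmorphM !rmorphB !rmorphMn.
by ring.
Qed.

(** Let [L = u * (T - c) ^ m.+1] be the leading coefficient, of true weight
    [w - r * N] once the denominator [f ^ N] is counted.  The leading
    coefficients [L_i] of the iterates satisfy
    [L_0 = 1] and [L_(i+1) = b_i * L' * L_i - (w - r * N) * L * L_i'] with
    [b_i = r + i * (w - r * N - l)].  By induction [L_i] has order exactly
    [m * i] at [c]: the step multiplies its lowest coefficient by [u(c)] and by
    [r * m.+1 + i * (w - r * N - l * m.+1)], a positive integer. *)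
Lemma ad_iter_neq0 r l N w c m u P :
    (0 < r)%N -> (size (weight_sub r l P) <= w.+1)%N ->
    (weight_sub r l P)`_w = u * ('X - c%:P) ^+ m.+1 -> ~~ root u c ->
    (l * m.+1 + r * N <= w)%N ->
  forall i, ad_iter N P i != 0.
Proof.
move=> r0 sX lcX uc lw i; set X := weight_sub r l P in sX lcX.
(* Scaled so that the recursion has neither division by r nor by a power of z. *)
pose Y i := ('X^(l * i) * weight_sub r l (ad_iter N P i)) *+ r ^ i.
have YS k : Y k.+1 = deriv_in X * (euler (Y k) - Y k *+ (l * k + r * (k * N)))
    - (euler X - X *+ (r * N)) * deriv_in (Y k).
  have thn (Z : W) n : euler (Z *+ n) = euler Z *+ n.
    by rewrite !eulerE derivMn mulrnAr.
  have E := weight_sub_twisted r l N (k * N) P (ad_iter N P k).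
  transitivity (('X^(l * k) *
    (('X^l * weight_sub r l (twisted_bracket N (k * N) P (ad_iter N P k))) *+ r)) *+ r ^ k).
    rewrite /Y /=; move: (weight_sub r l _) => B.
    by rewrite mulnS exprD expnS mulrnAr -mulrnA; ring.
  rewrite E /Y !(thn, raddfMn) /= eulerXnM deriv_inXnM -/X.
  by move: (weight_sub r l _) => A; ring.
have szin (Z : W) n : (size Z <= n)%N -> (size (deriv_in Z) <= n)%N.
  move=> /leq_sizeP sZ; apply/leq_sizeP => j nj.
  by rewrite coef_deriv_in sZ ?deriv0.
have szth (Z : W) n k : (size Z <= n)%N -> (size (euler Z - Z *+ k)%R <= n)%N.
  move=> /leq_sizeP sZ; apply/leq_sizeP => j nj.
  by rewrite coefB coef_euler coefMn sZ ?mul0rn ?subr0.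
have [uk ukc lcY] : exists2 v, ~~ root v c &
    (size (Y i) <= (r + i * w).+1)%N /\
    (Y i)`_(r + i * w) = v * ('X - c%:P) ^+ (m * i).
  elim: i => [|i [v vc [sY lcY]]].
    exists 1; first by rewrite rootE hornerC oner_eq0.
    rewrite /Y /= muln0 expn0 mulr1n expr0 mul1r muln0 addn0 /weight_sub bievalX.
    by rewrite size_polyXn coefXn eqxx expr0 mulr1.
  have top_eq : (r + i.+1 * w = w + (r + i * w))%N by lia.
  (* The true weight of the i-th iterate. *)
  set b := ((r + i * w)%:R - (l * i + r * (i * N))%:R : K).
  (* The part without the factor T - c carries the value at c. *)
  exists ((b * m.+1%:R - (w%:R - (r * N)%:R) * (m * i)%:R)%:P * (u * v)
      + ('X - c%:P) * (b%:P * u^`() * v - (w%:R - (r * N)%:R)%:P * u * v^`())).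
    rewrite rootE !hornerE /= subrr mul0r addr0 mulf_neq0 ?mulf_neq0 //.
    have -> : b * m.+1%:R - (w%:R - (r * N)%:R) * (m * i)%:R =
       (r * m.+1 + i * (w - (l * m.+1 + r * N)))%:R.
      rewrite /b -{1 2}(subnK lw) !(natrD, natrM); ring.
    by apply: (natf_neq0_pchar0 charK); nia.
  rewrite YS top_eq; split.
    apply: leq_trans (size_polyD _ _) _; rewrite size_polyN geq_max.
    by rewrite !size_mul_leq_top //; do ?[exact: szin | exact: szth].
  rewrite coefB !coefM_top //; do ?[exact: szin | exact: szth].
  rewrite !coefB !coef_euler !coef_deriv_in (coefMn (Y i)) (coefMn X) lcX lcY.
  have dpow k : ('X - c%:P) * (('X - c%:P) ^+ k)^`() = ('X - c%:P) ^+ k *+ k.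
    rewrite deriv_exp derivXsubC mul1r; case: k => [|k]; first by rewrite !mulr0n mulr0.
    by rewrite mulrnAr -exprS.
  have dG := dpow (m * i)%N.
  have dF : (('X - c%:P) ^+ m.+1)^`() = ('X - c%:P) ^+ m *+ m.+1.
    by rewrite deriv_exp derivXsubC mul1r.
  rewrite !derivM dF mulnS exprD exprS.
  rewrite /b !(polyCB, polyCM, polyC_natr).
  move: (('X - c%:P) ^+ (m * i)) (_^`()) dG => G D dG.
  move: (u^`()) (v^`()) (('X - c%:P) ^+ m) => u' v' F.
  apply/eqP; rewrite -subr_eq0; apply/eqP.
  transitivity (- ((w%:R - (r * N)%:R) * u * v * F *
    (('X - c%:P) * D - G *+ (m * i)))); last by rewrite dG subrr mulr0 oppr0.
  move: ('X - c%:P) => Z; ring.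
apply/eqP => Q0; case: lcY => _; rewrite /Y Q0 rmorph0 mulr0 mul0rn coef0.
move/esym/eqP; rewrite mulf_eq0 expf_eq0 polyXsubC_eq0 andbF orbF => /eqP v0.
by rewrite v0 root0 in ukc.
Qed.

End Criterion.
End Bipoly.

Arguments deriv_in {K}.
Arguments weight_sub {K}.
Arguments shear {K}.

(** * The side of the Newton polygon at its top vertex *)

Section NewtonEdge.
Variable K : closedFieldType.
Hypothesis charK : [pchar K] =i pred0.
Local Notation W := {poly {poly K}}.

(** P is the numerator of an element with denominator [f ^ m], so that the
    exponent [M = m + n] in P means the true exponent [n] of [f].  The bound
    [m <= n] is what leaves no room for two roots of the leading polynomial. *)
Lemma newton_edge_shear m n (P : W) : (m <= n)%N ->
    (size P <= (m + n).+1)%N -> P`_(m + n) != 0 ->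
    (exists k j, (0 < j)%N /\ (P`_k)`_j != 0) ->
    (exists i, ad_iter m P i = 0) ->
  (0 < n)%N /\
  exists c q, (0 < q)%N /\ (size (shear c q P) <= m + n)%N.
Proof.
set M := (m + n)%N => mn sP PM [k0 [j0 [j0_gt0 P0]]] [i0 Qi0].
have supp k j : (P`_k)`_j != 0 -> (k <= M)%N.
  case: (leqP k M) => // kM.
  by rewrite (nth_default 0 (leq_trans sP kM)) coef0 eqxx.
(* The monomial f^ks * h^r ends the side of least slope l / r from f^M. *)
have [l [r [r0 [[ks [ksM lE Ps]] sup_le]]]] : exists l r, (0 < r)%N /\
    (exists k, [/\ (k <= M)%N, l = (M - k)%N & (P`_k)`_r != 0]) /\
    (forall k j, (P`_k)`_j != 0 -> (l * j + r * k <= r * M)%N).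
  pose s := [seq x <- [seq (k, j) | k <- iota 0 (size P), j <- iota 0 (size P`_k)]
             | (0 < x.2)%N && ((P`_x.1)`_x.2 != 0)].
  have sE k j : ((k, j) \in s) = (0 < j)%N && ((P`_k)`_j != 0).
    rewrite mem_filter /=; case: ltnP => //= j_gt0; case: eqP => //= /eqP nz.
    have kP : (k < size P)%N.
      by case: ltnP nz => // kP; rewrite (nth_default 0 kP) coef0 eqxx.
    have jP : (j < size (P`_k)%R)%N.
      by case: ltnP nz => // jP; rewrite (nth_default 0 jP) eqxx.
    apply/allpairsPdep; exists k, j.
    by rewrite !mem_iota /= !add0n kP jP.
  have [||[k j]] := @min_ratio _ s (k0, j0) (fun x => M - x.1)%N (fun x => x.2).
  - by rewrite sE j0_gt0 P0.
  - by move=> [k j]; rewrite sE => /andP[].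
  rewrite sE => /andP[j_gt0 Pkj] minkj; exists (M - k)%N, j; split=> //; split.
    by exists k; split=> //; apply: supp Pkj.
  move=> k' j' Pk'; have kM' := supp _ _ Pk'.
  case: (posnP j') => [->|j'0]; first by nia.
  have /= := minkj (k', j'); rewrite sE j'0 Pk' => /(_ isT).
  rewrite mulnBl; nia.
pose X := weight_sub r l P; pose L := X`_(r * M).
have sX : (size X <= (r * M).+1)%N.
  apply/leq_sizeP => w Mw; apply/polyP => j; rewrite coef0; apply/eqP.
  apply: contraTT Mw => /coef_weight_sub_neq0[k -> Pk].
  by rewrite -ltnNge ltnS sup_le.
have Lnz j : L`_j != 0 -> exists2 k, (r * M = l * j + r * k)%N & (P`_k)`_j != 0.
  exact: coef_weight_sub_neq0.
have Lr : L`_r != 0.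
  have E : (l * r + r * ks = r * M)%N by rewrite lE mulnC -mulnDr subnK.
  by have := Ps; rewrite -(coef_weight_sub_monomial l P ks r r0) E.
have crit c u d : L = u * ('X - c%:P) ^+ d.+1 -> ~~ root u c ->
    (r * n < l * d.+1)%N.
  move=> LE uc; rewrite ltnNge; apply/negP => ln.
  have := @ad_iter_neq0 _ charK r l m (r * M) c d u P r0 sX LE uc _ i0.
  by rewrite Qi0 eqxx => /(_ _)/notF; apply; rewrite /M; nia.
have L0 : L != 0 by apply: contraNneq Lr => ->; rewrite coef0.
have sL : (1 < size L)%N.
  rewrite ltnNge; apply: contra Lr => sL.
  by rewrite (nth_default 0 (leq_trans sL r0)).
(* L is not constant, having the monomial T^r. *)
have [c rc] : exists c, root L c by apply/closed_rootP; rewrite neq_ltn sL orbT.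
have [d' [u]] := multiplicity_XsubC L c; rewrite L0 /= => uc LE.
case: d' => [|d] in LE; first by rewrite LE expr0 mulr1 (negPf uc) in rc.
have ln := crit _ _ _ LE uc.
have l0 : (0 < l)%N by case: (posnP l) ln => // ->.
(* As l > 0, the only monomial of P with exponent M in f is f^M itself. *)
have LM : L`_0 != 0.
  have [j Pj] : exists j, (P`_M)`_j != 0.
    by exists (size P`_M).-1; rewrite -lead_coefE lead_coef_eq0.
  have j0E : j = 0%N by have := sup_le _ _ Pj; nia.
  have := coef_weight_sub_monomial l P M 0 r0; rewrite muln0 add0n -/X -/L => ->.
  by rewrite -j0E.
have c0 : c != 0.
  by apply: contra LM => /eqP c0; have := rc; rewrite c0 rootE horner_coef0.
have u0 : u != 0 by apply: contraNneq uc => ->; rewrite root0.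
(* A second root would make l * deg L exceed 2 * r * n. *)
have su : size u = 1.
  apply/eqP; apply: contraT => /closed_rootP[c2 rc2].
  have c2c : c2 != c by apply: contraNneq uc => <-.
  have [e' [v]] := multiplicity_XsubC u c2; rewrite u0 /= => vc2 uE.
  case: e' => [|e] in uE; first by rewrite uE expr0 mulr1 (negPf vc2) in rc2.
  have v0 : v != 0 by apply: contraNneq vc2 => ->; rewrite root0.
  have LE2 : L = (v * ('X - c%:P) ^+ d.+1) * ('X - c2%:P) ^+ e.+1.
    by rewrite LE uE mulrAC.
  have ln2 : (r * n < l * e.+1)%N.
    apply: crit LE2 _; rewrite rootM negb_or vc2 /=.
    by rewrite root_exp_XsubC.
  have sizeL : size L = ((size v) + d.+1 + e.+1)%N.
    rewrite LE2 size_Mmonic ?monic_exp ?monicXsubC //; last first.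
      by rewrite mulf_neq0 ?expf_neq0 ?polyXsubC_eq0.
    rewrite size_Mmonic ?monic_exp ?monicXsubC //.
    by rewrite !size_exp_XsubC !addnS.
  have v1 : (0 < size v)%N by rewrite size_poly_gt0.
  have [|k rME _] := Lnz (size L).-1; first by rewrite -lead_coefE lead_coef_eq0.
  have : (l * (d.+1 + e.+1) <= r * M)%N.
    rewrite rME; apply: leq_trans (leq_addr _ _); rewrite leq_mul2l sizeL.
    by apply/orP; right; move: v1; case: (size v) => // t _; clear; lia.
  rewrite leqNgt => /negP[].
  have rM2 : (r * M <= r * n + r * n)%N.
    by rewrite -mulnDr leq_mul2l leq_add2r mn orbT.
  by apply: leq_ltn_trans rM2 _; rewrite mulnDr -addSn leq_add // ltnW.
(* The coefficient of T in a multiple of (T - c)^d.+1: here characteristic zero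
   makes the slope an integer. *)
have L1 : L`_1 != 0.
  have uE := size1_polyC (eq_leq su).
  have -> : L`_1 = (L^`())`_0 by rewrite coef_deriv mulr1n.
  rewrite LE uE derivM derivC mul0r add0r deriv_exp derivXsubC mul1r /=.
  rewrite -horner_coef0 !hornerE mulf_neq0 //.
    by apply: contraNneq u0 => u00; rewrite uE u00.
  rewrite hornerMn !hornerE -mulr_natr mulf_neq0 ?expf_neq0 ?oppr_eq0 //.
  exact: (natf_neq0_pchar0 charK).
have [k1 rME Pk1] := Lnz 1 L1.
have k1M := supp _ _ Pk1.
have lrq : l = (r * (M - k1))%N by rewrite mulnBr rME muln1 addnK.
have q0 : (0 < M - k1)%N by case: posnP => // q0; rewrite lrq q0 muln0 in l0.
split.
  have := leq_trans q0 (leq_subr _ _); rewrite /M; case: (n) mn => // m0.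
  by rewrite addn0; case: (m) m0.
exists c, (M - k1)%N; split=> //; set q := (M - k1)%N in lrq q0 *.
have sup_q k j : (P`_k)`_j != 0 -> (q * j + k <= M)%N.
  by move/sup_le; rewrite lrq -mulnA -mulnDr leq_pmul2l.
apply: (size_shear_lt q0).
  apply/leq_sizeP => w Mw; apply/polyP => j; rewrite coef0; apply/eqP.
  apply: contraTT Mw => /coef_weight_sub_neq0[k -> Pk].
  by rewrite -ltnNge ltnS mul1n sup_q.
(* Dividing both weights by r does not change the leading polynomial. *)
suff -> : (weight_sub 1 q P)`_M = L by [].
apply/polyP => j; have [qj|qj] := leqP (q * j) M.
  have ME : M = (q * j + 1 * (M - q * j))%N by rewrite mul1n subnKC.
  have E : (l * j + r * (M - q * j) = r * M)%N.
    by rewrite lrq -mulnA -mulnDr subnKC.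
  rewrite {1}ME coef_weight_sub_monomial //.
  by rewrite -(coef_weight_sub_monomial l P _ _ r0) E.
have [->|/coef_weight_sub_neq0[k E _]] := eqVneq (((weight_sub 1 q P)`_M)`_j) 0;
  last first.
  by rewrite E ltnNge leq_addr in qj.
apply/esym/eqP; apply: contraTT qj => /Lnz[k /eqP].
by rewrite lrq -mulnA -mulnDr eqn_pmul2l // => /eqP -> _; rewrite -leqNgt leq_addr.
Qed.

End NewtonEdge.

(** * The bracket on polynomials in f and h *)

Section Plambda.
Variables (K : fieldType) (lambda : K).
Hypothesis charK : [pchar K] =i pred0.
Local Notation W := {poly {poly K}}.
Local Notation PP := {mpoly K[3]}.
Local Notation A := (Plambda lambda).
Local Notation pi := (\pi_(Plambda lambda) : PP -> A).
Local Notation br := (@Plambda_bracket K lambda).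
Local Notation e := (Plambda_e lambda).
Local Notation h := (Plambda_h lambda).
Local Notation f := (Plambda_f lambda).

Local Notation H := (Psl2_H K).
Local Notation F := (Psl2_F K).

Lemma Plambda_ind (Pr : A -> Prop) :
    Pr 1 -> (forall c x y, Pr x -> Pr y -> Pr (c *: x + y)) ->
    (forall x, Pr x -> Pr (e * x)) -> (forall x, Pr x -> Pr (h * x)) ->
    (forall x, Pr x -> Pr (f * x)) -> forall x, Pr x.
Proof.
move=> Pr1 PrD Pre Prh Prf x; rewrite -[x]Plambda_piK; set p := repr x.
have PrX i y : Pr y -> Pr (pi 'X_i * y).
  by case: i => [[|[|[|//]]] ip] Pry;
    [move: (Pre _ Pry) | move: (Prh _ Pry) | move: (Prf _ Pry)];
    congr (Pr (pi 'X__ * y)); apply: val_inj.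
elim/mpolyind: p => [|c m p _ _ IHp].
  by have := PrD (-1) 1 1 Pr1 Pr1; rewrite scaleN1r addNr -(rmorph0 pi).
rewrite (Plambda_pi_is_linear lambda c); apply: (PrD) => //.
pose ok (q : PP) := forall y, Pr y -> Pr (pi q * y).
have ok1 : ok 1 by move=> y Pry; rewrite (rmorph1 pi) mul1r.
have okM q r : ok q -> ok r -> ok (q * r).
  by move=> okq okr y Pry; rewrite (rmorphM pi) -mulrA; apply/okq/okr.
suff /(_ 1 Pr1) : ok 'X_[m] by rewrite mulr1.
rewrite mpolyXE_id; apply: (big_ind ok) => // i _.
by elim: (m i) => [|k IHk]; rewrite ?expr0 // exprS; apply: okM => // y; exact: PrX.
Qed.

Lemma bracket_linear_l y : linear (br^~ y).
Proof. exact: (pbr_linearl (Plambda_bracket_poisson lambda)). Qed.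
Lemma bracket_linear_r x : linear (br x).
Proof. exact: (pbr_linearr (Plambda_bracket_poisson lambda)). Qed.

Lemma brDl x y z : br (x + y) z = br x z + br y z.
Proof. by have := bracket_linear_l z 1 x y; rewrite /= !scale1r. Qed.
Lemma brDr x y z : br x (y + z) = br x y + br x z.
Proof. by have := bracket_linear_r x 1 y z; rewrite !scale1r. Qed.
Lemma brxx x : br x x = 0.
Proof. exact: (pbr_alt (Plambda_bracket_poisson lambda)). Qed.
Lemma brC x y : br x y = - br y x.
Proof.
have := brxx (x + y); rewrite brDl !brDr !brxx addr0 add0r.
by move/eqP; rewrite addr_eq0 => /eqP.
Qed.
Lemma brMr x y z : br x (y * z) = br x y * z + y * br x z.
Proof. exact: (pbr_leibniz (Plambda_bracket_poisson lambda)). Qed.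
Lemma brMl x y z : br (x * y) z = br x z * y + x * br y z.
Proof. by rewrite brC brMr (brC z x) (brC z y); ring. Qed.
Lemma br1r x : br x 1 = 0.
Proof.
have := brMr x 1 1; rewrite !mulr1 mul1r => /eqP.
by rewrite -subr_eq0 opprD addrA subrr add0r oppr_eq0 => /eqP.
Qed.
Lemma brCr x c : br x c%:A = 0.
Proof.
have := bracket_linear_r x c 1 0; rewrite !addr0 => ->.
rewrite br1r scaler0 add0r.
by have := bracket_linear_r x (-1) 0 0; rewrite scaleN1r scaleN1r !addNr.
Qed.
Lemma brCl x c : br c%:A x = 0.
Proof. by rewrite brC brCr oppr0. Qed.

Lemma br0r x : br x 0 = 0.
Proof. by have := brCr x (0 : K); rewrite scale0r. Qed.
Lemma brNl x y : br (- x) y = - br x y.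
Proof.
by apply/eqP; rewrite -addr_eq0 -brDl addNr brC br0r oppr0.
Qed.
Lemma brNr x y : br x (- y) = - br x y.
Proof. by rewrite brC brNl brC opprK. Qed.
Lemma brZl c x y : br (c *: x) y = c *: br x y.
Proof. by rewrite -mulr_algl brMl brCl mul0r add0r mulr_algl. Qed.
Lemma brZr c x y : br x (c *: y) = c *: br x y.
Proof. by rewrite brC brZl (brC x) scalerN. Qed.
Lemma br_natl n x : br n%:R x = 0.
Proof. by rewrite -[n%:R]scaler_nat brCl. Qed.

Definition ev_fh : {rmorphism W -> A} := bieval (in_alg A) f h.
Definition ev_eh : {rmorphism W -> A} := bieval (in_alg A) e h.

Lemma ev_fhX : ev_fh 'X = f. Proof. exact: bievalX. Qed.
Lemma ev_fhY : ev_fh 'X%:P = h. Proof. exact: bievalY. Qed.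
Lemma ev_fhC c : ev_fh c%:P%:P = c%:A. Proof. exact: bievalCC. Qed.
Lemma ev_ehX : ev_eh 'X = e. Proof. exact: bievalX. Qed.
Lemma ev_eh_polyC p : ev_eh p%:P = ev_fh p%:P.
Proof. by rewrite /ev_eh /ev_fh !bievalC. Qed.

Lemma br_fh : br f h = 2 * f.
Proof. by rewrite brC Plambda_bracket_hf; ring. Qed.

(** The bracket with a fixed [y] is a derivation, so this is the chain rule. *)
Lemma br_ev_fh P y :
  br (ev_fh P) y = ev_fh P^`() * br f y + ev_fh (deriv_in P) * br h y.
Proof.
apply: (@bieval_chain_rule _ _ _ _ _ (br^~ y)) => [u v|u v|c]; first exact: brDl.
- by rewrite brMl; ring.
- exact: brCl.
Qed.

Lemma br_ev_fh_ev_fh P Q :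
  br (ev_fh P) (ev_fh Q) =
  - 2 * ev_fh (deriv_in P * euler Q - euler P * deriv_in Q).
Proof.
rewrite br_ev_fh !(brC _ (ev_fh Q)) !br_ev_fh !brxx br_fh Plambda_bracket_hf.
by rewrite !eulerE rmorphB !(rmorphM ev_fh) ev_fhX; ring.
Qed.

(** Clear the denominators with the Leibniz rule; the brackets with powers of
    [f] contribute the multiples of [N] and [M] in [twisted_bracket]. *)
Lemma br_twisted N M P Q x y : f ^+ N * x = ev_fh P -> f ^+ M * y = ev_fh Q ->
  f ^+ (N + M) * br x y = - 2 * ev_fh (twisted_bracket N M P Q).
Proof.
move=> xP yQ; have fX k : f ^+ k = ev_fh 'X^k by rewrite rmorphXn /= ev_fhX.
have dX k : deriv_in 'X^k = 0 :> W.
  by have := deriv_inXnM k (1 : W); rewrite mulr1 deriv_inC -polyC1 derivC mulr0.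
have tX k : euler 'X^k = 'X^k *+ k :> W.
  have := eulerXnM k (1 : W); rewrite mulr1 => ->.
  by rewrite eulerE -polyC1 derivC mulr0 add0r mulrnAr mulr1.
have ff k l : br (f ^+ k) (f ^+ l) = 0.
  by rewrite !fX br_ev_fh_ev_fh !dX mul0r mulr0 subrr rmorph0 mulr0.
have xf k : f ^+ N * br x (f ^+ k) = - 2 * f ^+ k * ev_fh (deriv_in P) *+ k.
  have := br_ev_fh_ev_fh P 'X^k; rewrite -xP -fX brMl ff mul0r add0r => ->.
  by rewrite dX tX mulr0 subr0 (rmorphM ev_fh) (rmorphMn ev_fh) -fX; ring.
have yf k : f ^+ M * br (f ^+ k) y = 2 * f ^+ k * ev_fh (deriv_in Q) *+ k.
  have := br_ev_fh_ev_fh 'X^k Q; rewrite -yQ -fX brMr ff mul0r add0r => ->.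
  by rewrite dX tX mul0r sub0r (rmorphN ev_fh) (rmorphM ev_fh) (rmorphMn ev_fh) -fX; ring.
have E := br_ev_fh_ev_fh P Q; rewrite -xP -yQ brMl !brMr ff mul0r add0r in E.
transitivity (- 2 * ev_fh (deriv_in P * euler Q - euler P * deriv_in Q)
    - f ^+ M * br (f ^+ N) y * x - f ^+ N * br x (f ^+ M) * y).
  by rewrite -E exprD; ring.
rewrite yf xf /twisted_bracket; apply/eqP; rewrite -subr_eq0; apply/eqP.
rewrite !(rmorphB ev_fh) !(rmorphM ev_fh) !(rmorphB ev_fh) !(rmorphMn ev_fh) -xP -yQ.
by ring.
Qed.

(** * Embedding into K[f, 1/f][h] *)

Definition poly_fh : {rmorphism W -> PP} := bieval (@mpolyC 3 K) F H.

Lemma poly_fhX : poly_fh 'X = F. Proof. exact: bievalX. Qed.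
Lemma poly_fhY : poly_fh 'X%:P = H. Proof. exact: bievalY. Qed.
Lemma poly_fhC c : poly_fh c%:P%:P = c%:MP. Proof. exact: bievalCC. Qed.

Lemma pi_mpolyC c : pi c%:MP = c%:A.
Proof. by rewrite -[RHS]/(pi c%:MP * 1) mulr1. Qed.

Lemma pi_poly_fh P : pi (poly_fh P) = ev_fh P.
Proof.
rewrite -[LHS]/((pi \o poly_fh) P); apply: bipoly_rmorph_eq => [c||].
- by rewrite ev_fhC -pi_mpolyC -[LHS]/(pi (poly_fh c%:P%:P)) poly_fhC.
- by rewrite ev_fhX -[LHS]/(pi (poly_fh 'X)) poly_fhX.
- by rewrite ev_fhY -[LHS]/(pi (poly_fh 'X%:P)) poly_fhY.
Qed.

(** Maps out of the quotient are given by maps out of K[E, H, F] that kill the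
    Casimir relation. *)
Section Mmap.
Variables (B : comNzRingType) (iota : {rmorphism K -> B}) (v : 'I_3 -> B).
Definition ev_gens : {rmorphism PP -> B} := mmap iota v.
Lemma ev_gensX i : ev_gens 'X_i = v i. Proof. by rewrite /ev_gens /= mmapX mmap1U. Qed.
Lemma ev_gensC c : ev_gens c%:MP = iota c. Proof. by rewrite /ev_gens /= mmapC. Qed.
Lemma ev_gens_Casimir :
  ev_gens (Casimir K - lambda%:MP) = 4 * v 0 * v 2 + v 1 ^+ 2 - iota lambda.
Proof.
rewrite /Casimir (rmorphB ev_gens) (rmorphD ev_gens) (rmorphXn ev_gens) !(rmorphM ev_gens).
by rewrite (rmorph_nat ev_gens) ev_gensC !ev_gensX.
Qed.
End Mmap.

(** The polynomial in [h] equal to [e * f]; see [mul_ef]. *)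
Definition ef_poly : {poly K} := 4^-1 *: (lambda%:P - 'X^2).

Lemma ef_polyE : 4 * ef_poly = lambda%:P - 'X^2.
Proof.
rewrite -[4]polyC_natr /ef_poly mul_polyC scalerA divff ?scale1r //.
exact: (natf_neq0_pchar0 charK (n := 4)).
Qed.

Lemma ef_poly_neq0 : ef_poly != 0.
Proof.
have : size ('X^2 - lambda%:P) = 3 by rewrite size_XnsubC.
rewrite -opprB -ef_polyE size_polyN; case: eqP => // ->.
by rewrite mulr0 size_poly0.
Qed.

(** Sending [e] to [ef_poly(h) / f] maps the quotient to the fraction field of
    K[f][h], and this map restricts to the inclusion on polynomials. *)
Lemma ev_fh_inj P : ev_fh P = 0 -> P = 0.
Proof.
rewrite -pi_poly_fh -(rmorph0 pi) => /eqP/Plambda_piP[r]; rewrite subr0 => PE.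
pose t : {rmorphism W -> {fraction W}} := @tofrac _.
pose iota : {rmorphism K -> {fraction W}} := t \o (polyC \o polyC).
pose v (i : 'I_3) := match val i with
  | 0 => t ef_poly%:P / t 'X | 1 => t 'X%:P | _ => t 'X end.
have tX : t 'X != 0 by rewrite tofrac_eq0 polyX_eq0.
have cas0 : ev_gens iota v (Casimir K - lambda%:MP) = 0.
  rewrite ev_gens_Casimir /v /= mulrA divfK //.
  have -> : 4 = t 4 by rewrite rmorph_nat.
  rewrite -rmorphM -rmorphXn /= -(rmorphD t) -(rmorphB t) -[4]polyC_natr -rmorphM.
  by rewrite ef_polyE -rmorphXn -!rmorphD -rmorphB /= subrK subrr rmorph0.
have : t P = 0.
  have <- : ev_gens iota v (poly_fh P) = t P.
    rewrite -[LHS]/((ev_gens iota v \o poly_fh) P); apply: bipoly_rmorph_eq => [c||] /=.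
    - by rewrite poly_fhC /= ev_gensC.
    - by rewrite poly_fhX ev_gensX.
    - by rewrite poly_fhY ev_gensX.
  by rewrite PE rmorphM cas0 mulr0.
by move/eqP; rewrite tofrac_eq0 => /eqP.
Qed.

(** In the quotient by [f] and [e] only K[h] modulo [h ^ 2 - lambda] is left. *)
Lemma mul_f_ev_fh a Q : f * a = ev_fh Q ->
  exists g, Q`_0 = g * ('X^2 - lambda%:P).
Proof.
rewrite -[a]Plambda_piK -pi_poly_fh -(rmorphM pi); move: (repr a) => p.
move/eqP/Plambda_piP => [r rE].
pose v (i : 'I_3) : {poly K} := match val i with 1 => 'X | _ => 0 end.
exists (- ev_gens (@polyC K) v r).
have <- : ev_gens (@polyC K) v (poly_fh Q) = Q`_0.
  rewrite -horner_coef0 -[RHS]/(horner_eval 0 Q).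
  rewrite -[LHS]/((ev_gens (@polyC K) v \o poly_fh) Q); apply: bipoly_rmorph_eq => [c||] /=.
  - by rewrite poly_fhC /= ev_gensC /horner_eval hornerC.
  - by rewrite poly_fhX ev_gensX /horner_eval hornerX.
  - by rewrite poly_fhY ev_gensX /horner_eval hornerC.
have := congr1 (ev_gens (@polyC K) v) rE.
rewrite rmorphB !rmorphM ev_gens_Casimir ev_gensX /v /= !mulr0 !mul0r sub0r add0r.
by move/eqP; rewrite eqr_oppLR mulNr => /eqP.
Qed.

(** A multiple of [h ^ 2 - lambda] of degree at most one vanishes. *)
Lemma mul_f_ev_fh_linear a (Q : W) (b c : K) :
  f * a = ev_fh Q -> Q`_0 = b%:P * 'X + c%:P -> b = 0 /\ c = 0.
Proof.
move=> /mul_f_ev_fh[g gE] QE; suff /polyP Z : b%:P * 'X + c%:P = 0.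
  have := Z 1%N; have := Z 0%N; rewrite !coefD !coefMX !coef0 !coefC /=.
  by rewrite add0r addr0.
have sQ : (size (b%:P * 'X + c%:P)%R <= 2)%N.
  by rewrite size_MXaddC; case: ifP => // _; rewrite size_polyC; case: (_ != 0).
rewrite -QE gE; move: sQ; rewrite -QE gE.
have mX : 'X^2 - lambda%:P \is monic by rewrite monicE lead_coefXnsubC.
have [->|g0] := eqVneq g 0; first by rewrite mul0r.
rewrite size_Mmonic // size_XnsubC // addn3 /=.
by move: g0; rewrite -size_poly_gt0; case: (size g).
Qed.

Lemma mul_ef : e * f = ev_fh ef_poly%:P.
Proof.
have -> : ef_poly%:P = (4^-1)%:P%:P * (lambda%:P%:P - 'X%:P ^+ 2).
  by rewrite -rmorphXn -!polyCB -polyCM mul_polyC.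
rewrite (rmorphM ev_fh) (rmorphB ev_fh) (rmorphXn ev_fh) !ev_fhC ev_fhY.
rewrite -Plambda_rel addrK !mulrA.
have -> : (4^-1)%:A * 4 = 1 :> A.
  rewrite mulr_algl -[4]/(1 *+ 4) -scaler_nat scalerA mulVf ?scale1r //.
  exact: (natf_neq0_pchar0 charK (n := 4)).
by rewrite mul1r.
Qed.

(** * Normal forms *)

Definition normal_form (m n : nat) (a : A) : Prop :=
  exists U V : W,
    [/\ (size U <= m.+1)%N, (size V <= n.+1)%N & a = ev_eh U + ev_fh V].

Lemma poly_case (P : W) : exists Q p, P = Q * 'X + p%:P.
Proof.
elim/poly_ind: P => [|Q p _]; last by exists Q, p.
by exists 0, 0; rewrite mul0r addr0.
Qed.

(** Powers of [e] and [f] never occur together because [e * f] is a polynomial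
    in [h]. *)
Lemma normal_form_ex a : exists m n, normal_form m n a.
Proof.
suff [U [V aE]] : exists U V, a = ev_eh U + ev_fh V.
  by exists (size U), (size V), U, V; split.
have ev_ehY : ev_eh 'X%:P = h by rewrite ev_eh_polyC ev_fhY.
have ev_ehC c : ev_eh c%:P%:P = c%:A by rewrite ev_eh_polyC ev_fhC.
elim/Plambda_ind: a => [|c x y|x|x|x].
- by exists 0, 1; rewrite rmorph0 rmorph1 add0r.
- move=> [U [V ->]] [U' [V' ->]].
  exists (c%:P%:P * U + U'), (c%:P%:P * V + V').
  rewrite !(rmorphD ev_eh) !(rmorphD ev_fh) (rmorphM ev_eh) (rmorphM ev_fh).
  by rewrite ev_ehC ev_fhC !mulr_algl scalerDr; ring.
- move=> [U [V ->]]; have [Q [p ->]] := poly_case V.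
  exists ('X * (U + p%:P)), (Q * ef_poly%:P).
  rewrite !(rmorphD ev_fh) !(rmorphM ev_eh) !(rmorphM ev_fh) (rmorphD ev_eh).
  by rewrite ev_fhX ev_ehX -mul_ef ev_eh_polyC; ring.
- move=> [U [V ->]]; exists ('X%:P * U), ('X%:P * V).
  by rewrite (rmorphM ev_eh) (rmorphM ev_fh) ev_ehY ev_fhY mulrDr.
- move=> [U [V ->]]; have [Q [p ->]] := poly_case U.
  exists (Q * ef_poly%:P), ('X * (V + p%:P)).
  rewrite !(rmorphD ev_eh) !(rmorphM ev_eh) !(rmorphM ev_fh) (rmorphD ev_fh).
  by rewrite ev_fhX ev_ehX ev_eh_polyC (ev_eh_polyC ef_poly) -mul_ef; ring.
Qed.

(** The numerator of U(e, h) over [f ^ m]: the monomial [e ^ i] becomes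
    [f ^ (m - i) * ef_poly ^ i]. *)
Definition clear_e (m : nat) (U : W) : W :=
  \poly_(k < m.+1) (ef_poly ^+ (m - k) * U`_(m - k)).

Lemma ev_fh_clear_e m (U : W) :
  (size U <= m.+1)%N -> f ^+ m * ev_eh U = ev_fh (clear_e m U).
Proof.
move=> sU; have UE : U = \poly_(i < m.+1) U`_i.
  apply/polyP => i; rewrite coef_poly; case: ltnP => // mi.
  by rewrite nth_default // (leq_trans sU).
rewrite {1}UE /clear_e !poly_def (rmorph_sum ev_eh) (rmorph_sum ev_fh) mulr_sumr.
rewrite (reindex_inj rev_ord_inj); apply: eq_bigr => i _ /=.
have im : (i <= m)%N by rewrite -ltnS.
rewrite subSS -!mul_polyC polyCM (rmorphXn polyC) !(rmorphM ev_eh) !(rmorphM ev_fh).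
rewrite !(rmorphXn ev_eh) !(rmorphXn ev_fh) ev_ehX ev_fhX ev_eh_polyC -mul_ef.
by rewrite -{1}(subnK im) exprD exprMn; ring.
Qed.

Lemma f_expE m P : f ^+ m * ev_fh P = ev_fh ('X^m * P).
Proof. by rewrite (rmorphM ev_fh) (rmorphXn ev_fh) ev_fhX. Qed.

Lemma ev_fh_clear_normal_form m (U V : W) : (size U <= m.+1)%N ->
  f ^+ m * (ev_eh U + ev_fh V) = ev_fh (clear_e m U + 'X^m * V).
Proof. by move=> sU; rewrite mulrDr ev_fh_clear_e // f_expE -(rmorphD ev_fh). Qed.

(** In [f ^ m.+1 * (U + V)] each coefficient of U and V appears, up to a power
    of [ef_poly], at its own power of [f], apart from the two constant ones,
    which are added. *)
Lemma f_nonzerodiv a : f * a = 0 -> a = 0.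
Proof.
move=> fa; have [m [n [U [V [sU sV aE]]]]] := normal_form_ex a.
have : f ^+ m.+1 * a = 0 by rewrite exprSr -mulrA fa mulr0.
rewrite aE ev_fh_clear_normal_form ?(leq_trans sU) //; move=> /ev_fh_inj/polyP coefs.
have U0 i : U`_i.+1 = 0.
  have [im|mi] := ltnP i m.+1; last by rewrite nth_default // (leq_trans sU) // leqW.
  have := coefs (m.+1 - i.+1)%N; rewrite coefD coef_poly coefXnM coef0 ltn_subrL /=.
  rewrite addr0 ltnS leq_subr subKn // => /eqP.
  by rewrite mulf_eq0 expf_eq0 (negPf ef_poly_neq0) andbF => /eqP.
have V0 i : V`_i.+1 = 0.
  have := coefs (m.+1 + i.+1)%N; rewrite coefD coef_poly coefXnM coef0.
  rewrite !ifF ?addKn ?add0r //; apply/negbTE; rewrite -leqNgt ?leq_addr //.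
  by rewrite addnS ltnS leq_addr.
have UV0 : U`_0 + V`_0 = 0.
  have := coefs m.+1; rewrite coefD coef_poly coefXnM coef0 ltnS leqnn ltnn subnn.
  by rewrite expr0 mul1r.
have UE : U = (U`_0)%:P by apply/polyP => -[|i]; rewrite coefC ?U0.
have VE : V = (V`_0)%:P by apply/polyP => -[|i]; rewrite coefC ?V0.
by rewrite UE VE ev_eh_polyC -(rmorphD ev_fh) -polyCD UV0 rmorph0.
Qed.

Lemma f_expr_nonzerodiv m a : f ^+ m * a = 0 -> a = 0.
Proof.
by elim: m => [|m IH]; rewrite ?mul1r // exprS -mulrA => /f_nonzerodiv.
Qed.

Lemma f_expr_inj m a b : f ^+ m * a = f ^+ m * b -> a = b.
Proof.
move=> /eqP; rewrite -subr_eq0 -mulrBr => /eqP/f_expr_nonzerodiv/eqP.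
by rewrite subr_eq0 => /eqP.
Qed.

Lemma ev_fh_of_normal_form m n a : normal_form m n a ->
  exists2 P : W, (size P <= (m + n).+1)%N & f ^+ m * a = ev_fh P.
Proof.
move=> [U [V [sU sV ->]]]; exists (clear_e m U + 'X^m * V).
  rewrite (leq_trans (size_polyD _ _)) // geq_max; apply/andP; split.
    by rewrite (leq_trans (size_poly _ _)) // ltnS leq_addr.
  rewrite (leq_trans (size_polyMleq _ _)) // size_polyXn addSn /= -addnS.
  by rewrite leq_add2l.
exact: ev_fh_clear_normal_form.
Qed.

(** Compare with an arbitrary normal form after a further multiplication by a
    power of [f]: its coefficients beyond the bounds must vanish. *)
Lemma normal_form_of_ev_fh m n a (P : W) : f ^+ m * a = ev_fh P ->
  (size P <= (m + n).+1)%N -> normal_form m n a.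
Proof.
move=> aP sP; have [m' [n' [U [V [sU sV aE]]]]] := normal_form_ex a.
have : f ^+ (m' + m) * a = ev_fh ('X^m' * P).
  by rewrite exprD -mulrA aP f_expE.
rewrite aE ev_fh_clear_normal_form; last by rewrite (leq_trans sU) // ltnS leq_addr.
move/eqP; rewrite -subr_eq0 -(rmorphB ev_fh) => /eqP/ev_fh_inj/eqP.
rewrite subr_eq0 => /eqP/polyP coefs.
exists U, V; split=> //; apply/leq_sizeP => i mi.
  have [im|im] := ltnP i m'.+1; last by rewrite nth_default // (leq_trans sU).
  have := coefs (m' + m - i)%N; rewrite coefD coef_poly !coefXnM.
  have [lt1 lt2 lt3 lt4] : [/\ (m' + m - i < m')%N, (m' + m - i < (m' + m).+1)%N,
      (m' + m - i < m' + m)%N & (i <= m' + m)%N] by clear -mi im; split; lia.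
  rewrite lt1 lt2 lt3 subKn // addr0 => /eqP.
  by rewrite mulf_eq0 expf_eq0 (negPf ef_poly_neq0) andbF => /eqP.
have := coefs (m' + m + i)%N; rewrite coefD coef_poly !coefXnM.
have [-> -> ->] : [/\ (m' + m + i < (m' + m).+1)%N = false,
    (m' + m + i < m' + m)%N = false & (m' + m + i < m')%N = false].
  by clear -mi; split; lia.
rewrite add0r addKn => ->; rewrite -addnA addKn; apply: nth_default.
by rewrite (leq_trans sP) // -addnS leq_add2l.
Qed.

Lemma horner_alg_ev_fh p : horner_alg f p = ev_fh (p^:P).
Proof. exact/esym/bieval_map_polyC. Qed.

(** If [f * b = p(f)], then the constant term of [p] is a multiple of
    [h ^ 2 - lambda], hence zero, and [f] can be cancelled. *)
Lemma polyf_saturated m a (p : {poly K}) : f ^+ m * a = horner_alg f p ->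
  exists q, a = horner_alg f q.
Proof.
elim: m p => [|m IH] p; first by rewrite mul1r => ->; exists p.
rewrite exprS -mulrA => fE; have fE' := fE; rewrite horner_alg_ev_fh in fE'.
have [_ p0] : 0 = 0 :> K /\ p`_0 = 0.
  by apply: (mul_f_ev_fh_linear fE'); rewrite coef_map polyC0 mul0r add0r.
have /factor_theorem[q pE] : root p 0 by rewrite rootE horner_coef0 p0.
apply: (IH q); apply: (f_expr_inj (m := 1)); rewrite expr1 fE pE.
by rewrite subr0 rmorphM /= horner_algX mulrC.
Qed.

(** * Local nilpotency and the centralizer of f *)

Lemma inner_constant (P : W) : (forall k j, (0 < j)%N -> (P`_k)`_j = 0) ->
  exists p : {poly K}, P = p^:P.
Proof.
move=> P0; exists (\poly_(k < size P) (P`_k)`_0); apply/polyP => k.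
rewrite coef_map coef_poly; case: ltnP => [kP|Pk]; last first.
  by rewrite nth_default.
by apply/polyP => -[|j]; rewrite coefC // P0.
Qed.

(** The bracket with [f] acts on K[f, 1/f][h] as [2 * f * d/dh]. *)
Lemma br_f_ev_fh N a P : f ^+ N * a = ev_fh P ->
  f ^+ N * br f a = ev_fh (2 * 'X * deriv_in P).
Proof.
move=> aP; have -> : f ^+ N * br f a = br f (f ^+ N * a).
  suff fN : br f (f ^+ N) = 0 by rewrite brMr fN mul0r add0r.
  elim: N {aP} => [|N IH]; first by rewrite br1r.
  by rewrite exprS brMr brxx IH; ring.
rewrite aP brC br_ev_fh brxx (brC h f) br_fh !(rmorphM ev_fh) ev_fhX rmorph_nat.
by ring.
Qed.

Lemma deriv_in_eq0_coef (P : W) k j :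
  deriv_in P = 0 -> (0 < j)%N -> (P`_k)`_j = 0.
Proof.
move=> dP; case: j => // j _; have := coef_deriv_in P k.
rewrite dP coef0 => /(congr1 (fun q : {poly K} => q`_j)).
rewrite coef0 coef_deriv => /esym/eqP; rewrite -mulr_natr mulf_eq0.
by rewrite (negPf (natf_neq0_pchar0 charK (ltn0Sn j))) orbF => /eqP.
Qed.

Lemma bipoly_mul2_eq0 (P : W) : 2 * P = 0 -> P = 0.
Proof.
move/eqP; rewrite mulf_eq0 => /orP[|/eqP //].
rewrite -[2](rmorph_nat (polyC \o polyC)) /= !polyC_eq0.
by rewrite (negPf (natf_neq0_pchar0 charK (n := 2) isT)).
Qed.

(** An element killed by [d/dh] has no [h] in characteristic zero. *)
Lemma centralizer_f a : br f a = 0 -> exists p, a = horner_alg f p.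
Proof.
move=> fa; have [m [n /ev_fh_of_normal_form[P _ aP]]] := normal_form_ex a.
have := br_f_ev_fh aP; rewrite fa mulr0 => /esym/ev_fh_inj/eqP.
rewrite -mulrA => /eqP/bipoly_mul2_eq0/eqP; rewrite mulf_eq0 polyX_eq0 /= => /eqP dP.
have [p PE] := inner_constant (fun k j => @deriv_in_eq0_coef P k j dP).
by apply: (@polyf_saturated m _ p); rewrite aP PE horner_alg_ev_fh.
Qed.

(** Each application lowers the degree in [h] of the numerator. *)
Lemma ad_f_nilpotent a : exists i, iter i (br f) a = 0.
Proof.
have [m [n /ev_fh_of_normal_form[P _ aP]]] := normal_form_ex a.
pose d := \max_(k < size P) size (P`_k)%R.
have sP k : (size (P`_k)%R <= d)%N.
  have [kP|Pk] := ltnP k (size P); last by rewrite nth_default // size_poly0.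
  exact: (leq_bigmax (Ordinal kP)).
exists d; clearbody d; elim: d a P aP sP => [|i IH] a P aP sP.
  apply: (f_expr_nonzerodiv (m := m)); rewrite aP.
  have -> : P = 0; last exact: rmorph0.
  by apply/polyP => k; rewrite coef0; apply/eqP; rewrite -size_poly_leq0.
rewrite iterSr; apply: IH (br_f_ev_fh aP) _ => k.
rewrite -mulrA -[2](rmorph_nat (polyC \o polyC)) /= coefCM coefXM.
case: k => [|k] /=; first by rewrite mulr0 size_poly0.
rewrite coef_deriv_in mul_polyC (leq_trans (size_scale_leq _ _)) //.
by rewrite (leq_trans (size_poly _ _)) //; case: (size _) (sP k).
Qed.

Lemma ev_fh_ad_iter N P a : f ^+ N * a = ev_fh P -> forall i,
  f ^+ (i * N) * iter i (br a) f = ev_fh ((- 2) ^+ i * ad_iter N P i).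
Proof.
move=> aP; elim=> [|i IH]; first by rewrite mul0n mul1r mul1r ev_fhX.
rewrite mulSn iterS (br_twisted aP IH) /= exprS.
have twZ (c : K) Q : twisted_bracket N (i * N) P (c%:P%:P * Q) =
    c%:P%:P * twisted_bracket N (i * N) P Q.
  rewrite /twisted_bracket !eulerE derivM derivC mul0r add0r deriv_inM deriv_inC derivC.
  by rewrite mul0r add0r; ring.
have -> : (- 2) ^+ i = ((- 2) ^+ i)%:P%:P :> W.
  by rewrite !rmorphXn !rmorphN /= !rmorph_nat.
by rewrite twZ -mulrA (rmorphM ev_fh (- 2)) rmorphN rmorph_nat.
Qed.

(** * Constructing the automorphisms *)

Section Linear.
Variables (u : A -> A) (ul : linear u).

Lemma lin0 : u 0 = 0.
Proof. by have := ul (-1) 0 0; rewrite !scaleN1r !addNr. Qed.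
Lemma linD x y : u (x + y) = u x + u y.
Proof. by have := ul 1 x y; rewrite !scale1r. Qed.
Lemma linZ c x : u (c *: x) = c *: u x.
Proof. by have := ul c x 0; rewrite lin0 !addr0. Qed.
Lemma linN x : u (- x) = - u x.
Proof. by rewrite -scaleN1r linZ scaleN1r. Qed.
Lemma lin_nat (u1 : u 1 = 1) n : u n%:R = n%:R.
Proof. by rewrite -scaler_nat linZ u1 scaler_nat. Qed.

End Linear.

Definition poisson_hom (u : A -> A) : Prop :=
  [/\ linear u, {morph u : x y / x * y}, u 1 = 1 & {morph u : x y / br x y}].

Lemma hom_ext (u v : A -> A) : poisson_hom u -> poisson_hom v ->
  u e = v e -> u h = v h -> u f = v f -> u =1 v.
Proof.
move=> [ul um u1 _] [vl vm v1 _] uve uvh uvf; elim/Plambda_ind => [|c x y|x|x|x].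
- by rewrite u1 v1.
- by rewrite ul vl => -> ->.
- by rewrite um vm uve => ->.
- by rewrite um vm uvh => ->.
- by rewrite um vm uvf => ->.
Qed.

(** The relations let the map on generators descend to the quotient.  Brackets
    are preserved because both sides are derivations in each argument and agree
    on generators. *)
Lemma poisson_hom_ex (e' h' f' : A) :
    4 * e' * f' + h' ^+ 2 = lambda%:A ->
    br e' f' = h' -> br h' e' = 2 * e' -> br h' f' = - 2 * f' ->
  exists u, poisson_hom u /\ [/\ u e = e', u h = h' & u f = f'].
Proof.
move=> rel bef bhe bhf.
pose v (i : 'I_3) : A := match val i with 0 => e' | 1 => h' | _ => f' end.
pose ph := ev_gens (in_alg A) v; pose u (x : A) := ph (repr x).
have phX i : ph 'X_i = v i by exact: ev_gensX.
have uE p : u (pi p) = ph p.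
  have /Plambda_piP[r rE] : pi (repr (pi p)) == pi p by rewrite Plambda_piK.
  apply/eqP; rewrite -subr_eq0 /u -(rmorphB ph) rE (rmorphM ph).
  by rewrite ev_gens_Casimir /v /= rel subrr mulr0.
have ue : u e = e' by rewrite uE phX.
have uh : u h = h' by rewrite uE phX.
have uf : u f = f' by rewrite uE phX.
have um : {morph u : x y / x * y}.
  move=> x y; rewrite -[x]Plambda_piK -[y]Plambda_piK -(rmorphM pi) !uE.
  exact: rmorphM.
have u1 : u 1 = 1 by have := uE 1; rewrite (rmorph1 pi) (rmorph1 ph).
have ul : linear u.
  move=> c x y; rewrite -[x]Plambda_piK -[y]Plambda_piK.
  rewrite -(Plambda_pi_is_linear lambda) !uE -mul_mpolyC (rmorphD ph) (rmorphM ph).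
  by rewrite /ph ev_gensC mulr_algl.
have [[[u0 uD] uN] un] := (lin0 ul, linD ul, linN ul, lin_nat ul u1).
exists u; split=> //; split=> //.
have gen x : [/\ u (br x e) = br (u x) e', u (br x h) = br (u x) h' &
                 u (br x f) = br (u x) f'] -> forall y, u (br x y) = br (u x) (u y).
  move=> [xe xh xf]; elim/Plambda_ind => [|c y z IHy IHz|y IH|y IH|y IH].
  - by rewrite u1 !br1r u0.
  - by rewrite brDr brZr !ul brDr brZr IHy IHz.
  - by rewrite brMr uD !um brMr IH xe ue.
  - by rewrite brMr uD !um brMr IH xh uh.
  - by rewrite brMr uD !um brMr IH xf uf.
have [bre [brh brf]] : (forall y, u (br e y) = br e' (u y)) /\
   (forall y, u (br h y) = br h' (u y)) /\ (forall y, u (br f y) = br f' (u y)).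
  have beh := Plambda_bracket_he lambda; have bhf0 := Plambda_bracket_hf lambda.
  have bef0 := Plambda_bracket_ef lambda.
  do 2?split; rewrite -?ue -?uh -?uf; apply: gen.
  - rewrite ue !brxx u0 (brC e h) beh bef0 uN um un ue uh (brC e' h') bhe bef.
    by split.
  - rewrite uh !brxx u0 beh bhf0 !um uN !un ue uf bhe bhf.
    by split.
  - rewrite uf !brxx u0 (brC f e) (brC f h) bef0 bhf0 !uN !um uN un uh uf.
    by rewrite (brC f' e') (brC f' h') bef bhf; split.
move=> x y; elim/Plambda_ind: x => [|c x z IHx IHz|x IH|x IH|x IH].
- by rewrite u1 !(brC 1) !br1r oppr0 u0.
- by rewrite brDl brZl !ul brDl brZl IHx IHz.
- by rewrite brMl uD !um brMl IH bre ue.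
- by rewrite brMl uD !um brMl IH brh uh.
- by rewrite brMl uD !um brMl IH brf uf.
Qed.

Lemma poisson_hom_comp u v : poisson_hom u -> poisson_hom v ->
  poisson_hom (u \o v).
Proof.
move=> [ul um u1 ub] [vl vm v1 vb]; split=> /= [c x y|x y||x y].
- by rewrite /= vl ul.
- by rewrite /= vm um.
- by rewrite v1 u1.
- by rewrite /= vb ub.
Qed.

(** It suffices to invert on the generators. *)
Lemma aut_of_homs u v : poisson_hom u -> poisson_hom v ->
    [/\ u (v e) = e, u (v h) = h & u (v f) = f] ->
    [/\ v (u e) = e, v (u h) = h & v (u f) = f] ->
  exists s : Plambda_aut lambda, forall x, s x = u x.
Proof.
move=> uP vP [uve uvh uvf] [vue vuh vuf].
have idP : poisson_hom id by split.
have uvK : cancel v u.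
  by move=> x; apply: (hom_ext (poisson_hom_comp uP vP) idP).
have vuK : cancel u v.
  by move=> x; apply: (hom_ext (poisson_hom_comp vP uP) idP).
have [ul um u1 ub] := uP.
have uA : is_poisson_aut br u by split=> //; exists v.
by exists (PoissonAut uA).
Qed.

Lemma hom_horner u (uP : poisson_hom u) x g :
  u (horner_alg x g) = horner_alg (u x) g.
Proof.
have [ul um u1 _] := uP; elim/poly_ind: g => [|g c IH].
  by rewrite !rmorph0 (lin0 ul).
rewrite !rmorphD !rmorphM /= !horner_algX !horner_algC -IH -um.
by rewrite addrC ul u1 addrC.
Qed.

Lemma br_horner x y g : br x (horner_alg y g) = horner_alg y g^`() * br x y.
Proof.
elim/poly_ind: g => [|g c IH].
  by rewrite deriv0 !rmorph0 mul0r br0r.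
rewrite derivD derivM derivC derivX !rmorphD !rmorphM /= !horner_algX rmorph0.
by rewrite horner_algC rmorph1 brDr brCr brMr IH; ring.
Qed.

Lemma tau_ex : exists t : Plambda_aut lambda, is_tau t.
Proof.
have [|||| u [uP [ue uh uf]]] := @poisson_hom_ex f (- h) e.
- by rewrite -(Plambda_rel lambda); ring.
- by rewrite brC Plambda_bracket_ef.
- by rewrite brNl Plambda_bracket_hf; ring.
- by rewrite brNl Plambda_bracket_he; ring.
have uN : forall x, u (- x) = - u x by have [ul _ _ _] := uP; apply: linN.
have uu : [/\ u (u e) = e, u (u h) = h & u (u f) = f].
  by rewrite ue uf uh uN uh ue opprK.
by have [s sE] := aut_of_homs uP uP uu uu; exists s; split; rewrite sE.
Qed.

Lemma Delta_hom (g : {poly K}) : exists u, poisson_hom u /\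
  [/\ u e = e - horner_alg f g * h - f * horner_alg f g ^+ 2,
      u h = h + 2 * f * horner_alg f g & u f = f].
Proof.
have bhf := Plambda_bracket_hf lambda; have bhe := Plambda_bracket_he lambda.
have bef := Plambda_bracket_ef lambda.
set G := horner_alg f g; pose G' := horner_alg f g^`().
have bhG : br h G = - 2 * f * G' by rewrite br_horner bhf mulrC.
have beG : br e G = G' * h by rewrite br_horner bef.
have bfG : br f G = 0 by rewrite br_horner brxx mulr0.
have bhf' : br f h = 2 * f by rewrite brC bhf; ring.
apply: poisson_hom_ex.
- by rewrite -(Plambda_rel lambda); ring.
- rewrite !expr2 !(brDl, brNl, brMl) bef bhf brxx !(brC G) bfG.
  by ring.
- rewrite !expr2 !(br_natl, brDl, brNl, brMl, brDr, brNr, brMr).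
  rewrite bhe bhf bhf' !brxx !(brC G) !(brC f e) bhG beG bfG bef.
  by ring.
- rewrite !(br_natl, brDl, brNl, brMl) bhf brxx !(brC G) bfG.
  by ring.
Qed.

(** The inverse of [Delta g] is [Delta (- g)]. *)
Lemma Delta_ex (g : {poly K}) : exists t : Plambda_aut lambda, is_Delta g t.
Proof.
have [u [uP [ue uh uf]]] := Delta_hom g.
have [v [vP [ve vh vf]]] := Delta_hom (- g).
have [ul um u1 _] := uP; have [vl vm v1 _] := vP.
have [[uD uN] u2] := (linD ul, linN ul, lin_nat ul u1 2).
have [[vD vN] v2] := (linD vl, linN vl, lin_nat vl v1 2).
have gN : horner_alg f (- g) = - horner_alg f g by exact: rmorphN.
have [||s sE] := aut_of_homs uP vP.
- rewrite ve vh vf !expr2 !(uD, uN, um, u2, hom_horner uP) ue uh uf gN.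
  by split=> //; ring.
- rewrite ue uh uf !expr2 !(vD, vN, vm, v2, hom_horner vP) ve vh vf gN.
  by split=> //; ring.
by exists s; split; rewrite sE.
Qed.

(** * Automorphisms acting on normal forms *)

Local Notation G := (Plambda_aut lambda).

Lemma autP (s : G) : poisson_hom s.
Proof.
by have [sl sm sb _] := poisson_autP s; split=> //; apply: poisson_aut_rmorph1.
Qed.

Lemma autM (s : G) x y : s (x * y) = s x * s y.
Proof. by have [_ -> _ _] := autP s. Qed.
Lemma aut1 (s : G) : s 1 = 1.
Proof. by have [_ _ -> _] := autP s. Qed.
Lemma autbr (s : G) x y : s (br x y) = br (s x) (s y).
Proof. by have [_ _ _ ->] := autP s. Qed.
Lemma autL (s : G) : linear s. Proof. by case: (autP s). Qed.
Lemma autD (s : G) x y : s (x + y) = s x + s y.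
Proof. exact: linD (autL s) _ _. Qed.
Lemma aut0 (s : G) : s 0 = 0. Proof. exact: lin0 (autL s). Qed.
Lemma autZ (s : G) c x : s (c *: x) = c *: s x.
Proof. exact: linZ (autL s) _ _. Qed.
Lemma autA (s : G) c : s c%:A = c%:A.
Proof. by rewrite autZ aut1. Qed.
Lemma autN (s : G) x : s (- x) = - s x.
Proof. exact: linN (autL s) _. Qed.
Lemma autXn (s : G) x n : s (x ^+ n) = s x ^+ n.
Proof. by elim: n => [|n IH]; rewrite ?aut1 // !exprS autM IH. Qed.
Lemma aut_nat (s : G) n : s n%:R = n%:R.
Proof. exact: lin_nat (autL s) (aut1 s) _. Qed.
Lemma autK (s : G) x : (s^-1)%g (s x) = x.
Proof. by rewrite -poisson_autME mulVg. Qed.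
Lemma autVK (s : G) x : s ((s^-1)%g x) = x.
Proof. by rewrite -poisson_autME mulgV. Qed.

Lemma aut_bieval (s : G) a b P :
  s (bieval (in_alg A) a b P) = bieval (in_alg A) (s a) (s b) P.
Proof.
pose L x y : {rmorphism {poly {poly K}} -> A} := bieval (in_alg A) x y.
have LC x y c : L x y c%:P%:P = c%:A by exact: bievalCC.
have LX x y : L x y 'X = x by exact: bievalX.
have LY x y : L x y 'X%:P = y by exact: bievalY.
rewrite -/(L a b) -/(L (s a) (s b)); move: L LC LX LY => L LC LX LY.
elim/bipoly_ind: P => [c|P Q IHP IHQ|P IH|P IH].
- by rewrite !LC autZ aut1.
- by rewrite !rmorphD autD IHP IHQ.
- by rewrite !rmorphM !LX autM IH.
- by rewrite !rmorphM !LY autM IH.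
Qed.

Lemma bieval_oppY x P :
  bieval (in_alg A) x (- h) P =
  bieval (in_alg A) x h (map_poly (comp_poly (- 'X)) P).
Proof.
pose n : {rmorphism W -> W} := map_poly (comp_poly (- 'X)).
pose u : {rmorphism W -> A} := bieval (in_alg A) x (- h).
pose v : {rmorphism W -> A} := bieval (in_alg A) x h.
have nX : n 'X = 'X by exact: map_polyX.
have nY : n 'X%:P = - 'X%:P by rewrite /n /= map_polyC /= comp_polyX polyCN.
have nC c : n c%:P%:P = c%:P%:P by rewrite /n /= map_polyC /= comp_polyC.
have uX : u 'X = x by exact: bievalX.
have uY : u 'X%:P = - h by exact: bievalY.
have uC c : u c%:P%:P = c%:A by exact: bievalCC.
have vX : v 'X = x by exact: bievalX.
have vY : v 'X%:P = h by exact: bievalY.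
have vC c : v c%:P%:P = c%:A by exact: bievalCC.
rewrite -[LHS]/(u P) -[RHS]/(v (n P)) -[RHS]/((v \o n) P).
move: n u v nX nY nC uX uY uC vX vY vC => n u v nX nY nC uX uY uC vX vY vC.
apply: bipoly_rmorph_eq => [c||].
- by rewrite uC -[RHS]/(v (n _)) nC vC.
- by rewrite uX -[RHS]/(v (n _)) nX vX.
- by rewrite uY -[RHS]/(v (n _)) nY (rmorphN v) vY.
Qed.

(** [tau] exchanges [e] and [f]; the sign of [h] is absorbed in the
    coefficients. *)
Lemma normal_form_tau (t : G) m n a : is_tau t ->
  normal_form m n a -> normal_form n m (t a).
Proof.
move=> [te th tf] [U [V [sU sV ->]]].
have sneg k (Q : W) : (size Q <= k)%N ->
    (size (map_poly (comp_poly (- 'X)) Q) <= k)%N.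
  move=> /leq_sizeP sQ; apply/leq_sizeP => i ki.
  by rewrite coef_map sQ //= comp_poly0.
exists (map_poly (comp_poly (- 'X)) V), (map_poly (comp_poly (- 'X)) U).
split; [exact: sneg | exact: sneg |].
rewrite autD /ev_eh /ev_fh !aut_bieval te tf th !bieval_oppY.
exact: addrC.
Qed.

Lemma two_neq0 : 2 != 0 :> K.
Proof. exact: (natf_neq0_pchar0 charK (n := 2)). Qed.

(** The exponent [q.-1] comes from [2 * f * g(f) = c * f ^ q]. *)
Lemma Delta_ev_fh (t : G) (c : K) q (P : W) : (0 < q)%N ->
  is_Delta ((c / 2) *: 'X^(q.-1)) t -> t (ev_fh P) = ev_fh (shear c q P).
Proof.
move=> q0 [_ th tf].
pose u : {rmorphism W -> A} := bieval (in_alg A) f (t h).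
have -> : t (ev_fh P) = u P by rewrite /ev_fh aut_bieval tf.
have uX : u 'X = f by exact: bievalX.
have uY : u 'X%:P = t h by exact: bievalY.
have uC d : u d%:P%:P = d%:A by exact: bievalCC.
rewrite -[RHS]/((ev_fh \o shear c q) P); move: u uX uY uC => u uX uY uC.
apply: bipoly_rmorph_eq => [d||].
- by rewrite uC -[RHS]/(ev_fh (shear c q _)) shearC ev_fhC.
- by rewrite uX -[RHS]/(ev_fh (shear c q _)) shearX ev_fhX.
rewrite uY -[RHS]/(ev_fh (shear c q _)) shearY th.
rewrite (rmorphD ev_fh) (rmorphM ev_fh) (rmorphXn ev_fh) ev_fhX ev_fhY ev_fhC.
congr (_ + _); rewrite -mul_polyC rmorphM rmorphXn /= horner_algC horner_algX.
rewrite -[in RHS](prednK q0) exprS.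
have -> : c%:A = 2 * (c / 2)%:A :> A.
  rewrite mulr_natl -scaler_nat scalerA mulrCA.
  by rewrite divff ?two_neq0 // mulr1.
by ring.
Qed.

End Plambda.

(** * Generation *)

Section Generation.
Variables (K : closedFieldType) (lambda : K).
Hypothesis charK : [pchar K] =i pred0.
Local Notation W := {poly {poly K}}.
Local Notation A := (Plambda lambda).
Local Notation br := (@Plambda_bracket K lambda).
Local Notation e := (Plambda_e lambda).
Local Notation h := (Plambda_h lambda).
Local Notation f := (Plambda_f lambda).
Local Notation ev_fh := (ev_fh lambda).
Local Notation G := (Plambda_aut lambda).

Variables (tau : G) (Delta : {poly K} -> G).
Hypothesis tauP : is_tau tau.
Hypothesis DeltaP : forall g, is_Delta g (Delta g).

Lemma four_neq0 : 4 != 0 :> K.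
Proof. exact: (natf_neq0_pchar0 charK (n := 4)). Qed.

(** The relation [4 * e * f = lambda - h ^ 2] determines the image of [e], since
    [f] is not a zero divisor. *)
Lemma aut_eq_fh (s t : G) (a : K) : a != 0 -> s f = a *: f -> t f = a *: f ->
  s h = t h -> s = t.
Proof.
move=> a0 sf tf sth; apply: Plambda_aut_ext => //; last by rewrite sf tf.
have rel (u : G) : u f = a *: f -> f * ((4 * a) *: u e) = lambda%:A - u h ^+ 2.
  move=> uf; have := congr1 u (Plambda_rel lambda).
  rewrite autA autD autXn !autM aut_nat uf => <-.
  rewrite addrK -[(4 * a) *: _]mulr_algl -[a *: f]mulr_algl.
  have -> : (4 * a)%:A = 4 * a%:A :> A by rewrite -scalerA scaler_nat mulr_natl.
  by ring.
have : f ^+ 1 * ((4 * a) *: s e) = f ^+ 1 * ((4 * a) *: t e).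
  by rewrite expr1 !rel // sth.
move/(f_expr_inj charK)/eqP; rewrite -subr_eq0 -scalerBr scaler_eq0.
by rewrite mulf_eq0 (negPf four_neq0) (negPf a0) subr_eq0 => /eqP.
Qed.

Lemma tauE : tau e = f. Proof. by case: tauP. Qed.
Lemma tauH : tau h = - h. Proof. by case: tauP. Qed.
Lemma tauF : tau f = e. Proof. by case: tauP. Qed.
Lemma DeltaE g : Delta g e = e - horner_alg f g * h - f * horner_alg f g ^+ 2.
Proof. by case: (DeltaP g). Qed.
Lemma DeltaH g : Delta g h = h + 2 * f * horner_alg f g.
Proof. by case: (DeltaP g). Qed.
Lemma DeltaF g : Delta g f = f. Proof. by case: (DeltaP g). Qed.

(* S is any subgroup containing the proposed generators. *)

Section Subgroup.
Variable S : {pred G}.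
Hypothesis Scl : group_closed S.
Hypothesis Stau : tau \in S.
Hypothesis SDelta : forall g, Delta g \in S.

Lemma in_mulL (t s : G) : t \in S -> (t * s)%g \in S -> s \in S.
Proof.
move=> tS tsS; rewrite -[s](mulKg t); apply: (group_closedM Scl) => //.
exact: (group_closedV Scl).
Qed.

(** A diagonal matrix of SL_2 as a word in unipotent matrices and the Weyl
    element.  With [b * c = -1] the word below maps [f] to [- b ^ 2 * f] and
    fixes [h], and [- b ^ 2] takes every nonzero value. *)
Lemma torus_in (a : K) : a != 0 ->
  exists t : G, [/\ t \in S, t f = a *: f & t h = h].
Proof.
move=> a0; have [b bE] : exists b : K, b ^+ 2 = - a.
  have : size ('X^2 + a%:P) != 1 by rewrite size_XnaddC.
  by move/closed_rootP => [b]; rewrite rootE !hornerE addr_eq0 => /eqP; exists b.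
have b0 : b != 0.
  by apply: contraNneq a0 => b0; move/eqP: bE; rewrite b0 expr0n eq_sym oppr_eq0.
pose c := - b^-1; have bc : b * c = - 1 by rewrite mulrN divff.
(* B and C are kept abstract, as a scalar multiple is by definition a product. *)
have [B BE] : exists B : A, B = b%:A by exists b%:A.
have [C CE] : exists C : A, C = c%:A by exists c%:A.
have BC : B * C = - 1 by rewrite BE CE -scalerAl mul1r scalerA bc scaleN1r.
have BB : B ^+ 2 = - a%:A.
  by rewrite BE expr2 -scalerAl mul1r scalerA -expr2 bE scaleNr.
pose t := (tau * (Delta c%:P * (tau * (Delta b%:P * (tau * Delta c%:P)))))%g.
have SM := group_closedM Scl.
have autB (s : G) : s B = B by rewrite BE autA.
have autC (s : G) : s C = C by rewrite CE autA.
have cE : Delta c%:P e = e - C * h - f * C ^+ 2 by rewrite DeltaE horner_algC -CE.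
have cH : Delta c%:P h = h + 2 * f * C by rewrite DeltaH horner_algC -CE.
have bE' : Delta b%:P e = e - B * h - f * B ^+ 2 by rewrite DeltaE horner_algC -BE.
have bH : Delta b%:P h = h + 2 * f * B by rewrite DeltaH horner_algC -BE.
have simp := (cE, cH, bE', bH, DeltaF, tauE, tauH, tauF, autB, autC, aut_nat,
  autN, autD, autXn, autM).
exists t; split.
- by rewrite /t; do 5?[apply: (SM); rewrite ?Stau ?SDelta //].
- rewrite /t !poisson_autME !simp.
  transitivity (e * (1 + B * C) ^+ 2 - h * B * (1 + B * C) - f * B ^+ 2).
    by ring.
  by rewrite BC subrr expr0n !mulr0 subrr sub0r BB mulrN opprK mulrC mulr_algl.
- rewrite /t !poisson_autME !simp.
  transitivity (h + (1 + B * C) * (- 2 * h + 2 * e * C + 2 * e * C * (1 + B * C)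
      - 2 * h * B * C - 2 * f * B)); first by ring.
  by rewrite BC subrr mul0r addr0.
Qed.

(** [s^-1 f] commutes with [f], because [f] commutes with [s f = p(f)]; so it is
    [q(f)], and then [f = p(q(f))] leaves degree one only. *)
Lemma image_f_affine (s : G) p : s f = horner_alg f p ->
  exists a b, a != 0 /\ s f = a *: f + b%:A.
Proof.
move=> sf; pose r : G := (s^-1)%g.
have [q rf] : exists q, r f = horner_alg f q.
  apply: (centralizer_f charK); apply: (can_inj (autK s)).
  by rewrite autbr autVK aut0 sf brC br_horner brxx mulr0 oppr0.
have pq : p \Po q = 'X.
  have : horner_alg f (p \Po q) = f.
    by rewrite -[RHS](autK s) sf (hom_horner (autP _)) -/r rf horner_alg_comp.
  rewrite -{2}(horner_algX f) !horner_alg_ev_fh => /eqP.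
  rewrite -subr_eq0 -(rmorphB ev_fh) => /eqP/(ev_fh_inj charK)/eqP.
  rewrite subr_eq0 => /eqP/polyP pqE; apply/polyP => k.
  by have := pqE k; rewrite !coef_map => /polyC_inj.
have sp : size p = 2.
  have := size_comp_poly p q; rewrite pq size_polyX /= => /esym/eqP.
  by rewrite muln_eq1 => /andP[/eqP + _]; case: (size p) => //= k ->.
have pE : p = (p`_1)%:P * 'X + (p`_0)%:P.
  apply/polyP => k; rewrite coefD coefCM coefX coefC.
  case: k => [|[|k]] /=; rewrite ?mulr0 ?mulr1 ?add0r ?addr0 //.
  by rewrite nth_default // sp.
exists p`_1, p`_0; split.
  have := lead_coef_eq0 p; rewrite lead_coefE sp => ->.
  by rewrite -size_poly_eq0 sp.
rewrite sf {1}pE rmorphD rmorphM /= !horner_algC horner_algX.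
by rewrite mulr_algl.
Qed.

(** Write [s f = a * f + b].  The bracket of [s h] with [s f] determines
    [d/dh (s h)], whence [f * s h = (f + b / a) * h + r1(f)].  Dividing by [f]
    in the algebra forces [b = 0] and [s h = h + r2(f)]; the defining relation
    then forces [r2(0) = 0], so that [s h] is the image of [h] under some
    [Delta g], and [s] differs from [Delta g] by a rescaling of [f]. *)
Lemma mem_of_image_f_poly (s : G) p : s f = horner_alg f p -> s \in S.
Proof.
move=> /image_f_affine[a [b [a0 sf]]].
have bhf : br (s h) (s f) = - 2 * s f.
  by rewrite -autbr Plambda_bracket_hf autM autN aut_nat.
pose b' := a^-1 * b.
have bfh : br f (s h) = 2 * (f + b'%:A).
  rewrite brC; have -> : f = a^-1 *: (s f) - b'%:A.
    by rewrite sf scalerDr !scalerA mulVf // scale1r addrK.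
  rewrite brDr brZr brNr brCr bhf subr0 subrK.
  by rewrite -[a^-1 *: (_ * _)]mulr_algl -[a^-1 *: s f]mulr_algl; ring.
have [r1 r1E] : exists r1, f * s h - (f + b'%:A) * h = horner_alg f r1.
  have [m [n /(ev_fh_of_normal_form charK)[P _ PE]]] := normal_form_ex charK (s h).
  have := br_f_ev_fh PE; rewrite bfh => dP.
  (* d/dh of f * P is that of f^m * (f + b') * h, so they differ by a
     polynomial in f. *)
  have {}dP : 2 * ('X * deriv_in P - 'X^m * ('X + b'%:P%:P)) = 0.
    apply: (ev_fh_inj charK (lambda := lambda)).
    rewrite mulrBr mulrA (rmorphB ev_fh) -dP !(rmorphM ev_fh) (rmorphXn ev_fh).
    by rewrite (rmorph_nat ev_fh) (rmorphD ev_fh) ev_fhX ev_fhC; ring.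
  have {}dP := bipoly_mul2_eq0 charK dP.
  pose Q := 'X * P - 'X^m * ('X + b'%:P%:P) * 'X%:P.
  have dQ : deriv_in Q = 0.
    rewrite /Q raddfB /= -mulrA (deriv_inXnM m) !deriv_inM deriv_inX raddfD /=.
    rewrite deriv_inX !deriv_inC.
    rewrite derivC derivX -[RHS]dP mul0r add0r polyC0 addr0 mul0r add0r.
    by rewrite mulr1.
  have [r1 rE] := inner_constant (fun k j => @deriv_in_eq0_coef _ charK Q k j dQ).
  apply: (@polyf_saturated _ _ charK m _ r1); rewrite horner_alg_ev_fh -rE.
  rewrite /Q (rmorphB ev_fh) !(rmorphM ev_fh) (rmorphXn ev_fh) (rmorphD ev_fh).
  rewrite ev_fhX ev_fhY ev_fhC -PE.
  by ring.
have E1 : f * (s h - h) = ev_fh (b'%:P%:P * 'X%:P + r1^:P).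
  rewrite (rmorphD ev_fh) (rmorphM ev_fh) ev_fhC ev_fhY -horner_alg_ev_fh -r1E; ring.
have [b'0 _] : b' = 0 /\ r1`_0 = 0.
  apply: (mul_f_ev_fh_linear E1).
  by rewrite -polyCM coefD coefC coef_map.
have {r1E E1} [r2 r2E] : exists r2, s h - h = horner_alg f r2.
  apply: (@polyf_saturated _ _ charK 1 _ r1).
  by rewrite expr1 E1 b'0 !polyC0 mul0r add0r horner_alg_ev_fh.
have b0 : b = 0.
  by move/eqP: b'0; rewrite mulf_eq0 invr_eq0 (negPf a0) => /eqP.
rewrite b0 scale0r addr0 in sf.
have shE : s h = h + horner_alg f r2 by rewrite -r2E addrC subrK.
have r20 : r2`_0 = 0.
  have E2 : f * (4 * a%:A * s e - 4 * e) =
      ev_fh (- (2 * 'X%:P * r2^:P) - r2^:P ^+ 2).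
    have := congr1 s (Plambda_rel lambda).
    rewrite autA autD autXn !autM aut_nat sf shE => rel2.
    rewrite (rmorphB ev_fh) (rmorphN ev_fh) (rmorphXn ev_fh) !(rmorphM ev_fh).
    rewrite (rmorph_nat ev_fh) ev_fhY -horner_alg_ev_fh.
    move: (horner_alg f r2) rel2 => R rel2.
    transitivity ((4 * s e * (a *: f) + (h + R) ^+ 2) - (4 * e * f + h ^+ 2)
      - 2 * h * R - R ^+ 2); first by rewrite -[a *: f]mulr_algl; ring.
    by rewrite rel2 Plambda_rel subrr sub0r.
  have [|_] := @mul_f_ev_fh_linear _ _ _ _ (- (2 * r2`_0)) (- (r2`_0 ^+ 2)) E2.
    rewrite coefB coefN expr2 !coef0M !coef_map coefC /=.
    have -> : (2 : W)`_0 = 2 by rewrite -polyC_natr coefC.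
    by rewrite !polyCN polyCM polyC_exp polyC_natr; ring.
  by move/eqP; rewrite oppr_eq0 expf_eq0 => /eqP.
have [g gE] : exists g, r2 = 2 *: ('X * g).
  have /factor_theorem[g gE] : root r2 0 by rewrite rootE horner_coef0 r20.
  exists (2^-1 *: g); rewrite -scalerAr scalerA divff ?(two_neq0 charK) // scale1r.
  by rewrite gE subr0 mulrC.
have [t [tS tf th]] := torus_in a0.
suff -> : s = (Delta g * t)%g by apply: (group_closedM Scl).
apply: (aut_eq_fh a0) => //.
  by rewrite poisson_autME tf autZ DeltaF.
rewrite poisson_autME th DeltaH shE gE.
rewrite -mul_polyC !rmorphM /= horner_algX horner_algC scaler_nat.
by rewrite mulrA.
Qed.

(** Induction on [m + n], the width of the Newton polygon of [s f]. *)
Lemma mem_of_normal_form N m n (s : G) : (m + n < N)%N ->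
  normal_form m n (s f) -> s \in S.
Proof.
elim: N => // N IH in m n s *.
wlog mn : m n s / (m <= n)%N => [hwlog|].
  have [|nm] := leqP m n; first exact: hwlog.
  move=> lt nf; apply: (in_mulL Stau).
  apply: (hwlog n m) => //; [exact: ltnW | by rewrite addnC |].
  by rewrite poisson_autME; exact: normal_form_tau.
rewrite ltnS => lt nf; have [P sP PE] := ev_fh_of_normal_form charK nf.
have [nonconst|const] := pselect (exists k j, (0 < j)%N /\ (P`_k)`_j != 0);
  last first.
  have [k j j0|p pE] := @inner_constant _ P.
    by apply/eqP; apply: contra_notT const => nz; exists k, j.
  have [q sf] : exists q, s f = horner_alg f q.
    by apply: (@polyf_saturated _ _ charK m _ p); rewrite PE pE horner_alg_ev_fh.
  exact: (mem_of_image_f_poly sf).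
(* It is enough to lower the degree in f of the numerator by some t in S. *)
have decr (t : G) : t \in S -> (0 < n)%N ->
    (exists2 Q : W, (size Q <= m + n)%N & f ^+ m * t (s f) = ev_fh Q) -> s \in S.
  move=> tS n0 [Q sQ QE]; apply: (in_mulL tS); apply: (IH m n.-1).
    by rewrite -(prednK n0) addnS in lt.
  apply: (normal_form_of_ev_fh charK (P := Q)); first by rewrite poisson_autME.
  by rewrite -addnS prednK.
have [PM0|PM] := eqVneq P`_(m + n) 0.
  have sP' : (size P <= m + n)%N.
    apply/leq_sizeP => j; rewrite leq_eqVlt => /predU1P[<- //|].
    by move/leq_sizeP: sP; apply.
  have n0 : (0 < n)%N.
    rewrite lt0n; apply/eqP => n0; have [k [j [_]]] := nonconst.
    have m0 : m = 0%N by move: mn; rewrite n0 leqn0 => /eqP.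
    move: sP'; rewrite n0 m0 size_poly_leq0 => /eqP ->.
    by rewrite !coef0 eqxx.
  apply: (decr 1%g) => //; first by case: Scl.
  by exists P => //; rewrite poisson_aut1E.
(* Conjugation by s carries the local nilpotency of ad f to that of ad (s f). *)
have nilp : exists i, ad_iter m P i = 0.
  have [i ti] := ad_f_nilpotent charK ((s^-1)%g f); exists i.
  have iterE : iter i (br (s f)) f = 0.
    rewrite -(aut0 s) -ti; elim: (i) => [|j IHj]; first by rewrite /= autVK.
    by rewrite !iterS IHj autbr.
  have := ev_fh_ad_iter PE i; rewrite iterE mulr0 => /esym/(ev_fh_inj charK)/eqP.
  rewrite mulf_eq0 => /orP[|/eqP //]; rewrite expf_eq0 => /andP[_].
  rewrite oppr_eq0 => /eqP two0; have := bipoly_mul2_eq0 charK (P := 1 : W).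
  by rewrite two0 mul0r => /(_ erefl)/eqP; rewrite oner_eq0.
have [n0 [c [q [q0 sQ]]]] := newton_edge_shear charK mn sP PM nonconst nilp.
apply: (decr (Delta ((c / 2) *: 'X^(q.-1)))) => //.
exists (shear c q P) => //.
rewrite -(Delta_ev_fh charK P q0 (DeltaP _)) -PE autM autXn.
by rewrite DeltaF.
Qed.

End Subgroup.
End Generation.

Theorem proposition1 (K : closedFieldType) (charK : [pchar K]%R =i pred0)
    (lambda : K) :
  exists (tau : Plambda_aut lambda) (Delta : {poly K} -> Plambda_aut lambda),
    [/\ is_tau tau,
        forall g : {poly K}, is_Delta g (Delta g)
      & forall s : Plambda_aut lambda,
          generated (fun t => t = tau \/ exists g, t = Delta g) s].
Proof.
have [tau tauP] := tau_ex lambda.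
have [Delta DeltaP] := choice (Delta_ex lambda).
exists tau, Delta; split=> // s S Scl gen.
have [m [n nf]] := normal_form_ex charK (s (Plambda_f lambda)).
apply: (mem_of_normal_form charK tauP DeltaP Scl _ _ (ltnSn _) nf).
  by apply: gen; left.
by move=> g; apply: gen; right; exists g.
Qed.
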